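(* Let $H$ be a complex Hilbert space and let $\lambda\in[0,1]$. For every $T\in\mathcal{B}(H)$ and each natural number $n$, $$r(T)=\inf\{w(\Delta_\lambda^n(XTX^{-1})) : X\in\mathcal{B}(H)\text{ invertible}\}=\inf\{w(\Delta_\lambda^n(e^{A}Te^{-A})) : A\in\mathcal{B}(H)\text{ self-adjoint}\}.$$
   Context: $H$ is a (nonzero) complex Hilbert space, $\mathcal{B}(H)$ is the space of bounded linear operators on $H$, and $r(T)$ is the spectral radius of $T$. The numerical range of $T$ is $W(T)=\{\langle Tx,x\rangle : \|x\|=1\}$ and its numerical radius is $w(T)=\sup\{|\mu| : \mu\in W(T)\}$. For $T\in\mathcal{B}(H)$, $|T|=(T^*T)^{1/2}$ and $T=U|T|$ is the unique polar decomposition, with $U$ the partial isometry satisfying $\ker U=\ker T$. For $\lambda\in[0,1]$ the $\lambda$-Aluthge transform is $\Delta_\lambda(T)=|T|^{\lambda}U|T|^{1-\lambda}$, with the convention $|T|^0=I$, so that $\Delta_0(T)=U|T|=T$ and $\Delta_1(T)=|T|U$. Its iterates are $\Delta_\lambda^0(T)=T$ and $\Delta_\lambda^{n+1}(T)=\Delta_\lambda(\Delta_\lambda^n(T))$. Natural numbers include $0$. *)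

(* Defs.v *)
From HB Require Import structures.
From mathcomp Require Import all_boot all_order all_algebra sesquilinear.
From mathcomp Require Import complex.
From mathcomp Require Import all_classical all_reals all_analysis.

Set Implicit Arguments.
Unset Strict Implicit.
Unset Printing Implicit Defensive.

Import Order.TTheory GRing.Theory Num.Theory.
Import numFieldNormedType.Exports.

Local Open Scope classical_set_scope.
Local Open Scope ring_scope.
Local Open Scope complex_scope.

(* The norm of a complex normed space is R[i]-valued; [rnorm x] is the same
   number as an element of R, where suprema and infima are taken. *)
Definition rnorm (R : realType) (V : normedModType R[i]) (x : V) : R :=
  complex.Re `|x|.

Lemma rnormE (R : realType) (V : normedModType R[i]) (x : V) :
  (rnorm x)%:C = `|x|.
Proof. by rewrite /rnorm RRe_real// normr_real. Qed.

Section bounded_operators.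
Context {R : realType} (V : normedModType R[i]).
Implicit Types f g : V -> V.

Definition bounded_linear : pred (V -> V) := [pred f : V -> V |
  `[< linear f /\ exists M : R[i], forall x, `|f x| <= M * `|x| >]].

Lemma bounded_linearP f : reflect
  (linear f /\ exists M : R[i], forall x, `|f x| <= M * `|x|)
  (f \in bounded_linear).
Proof. exact: asboolP. Qed.

Lemma bounded_linear_ge0 f : f \in bounded_linear ->
  exists2 M : R[i], 0 <= M & forall x, `|f x| <= M * `|x|.
Proof.
move=> /bounded_linearP[_ [M fM]]; exists `|M| => // x.
have Mx0 : 0 <= M * `|x| by rewrite (le_trans _ (fM x)).
by rewrite (le_trans (fM x))// -[leLHS]ger0_norm// normrM normr_id.
Qed.

Lemma bounded_linear_submod : submod_closed bounded_linear.
Proof.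
split.
  have f0 x : (0 : V -> V) x = 0 by [].
  apply/bounded_linearP; split=> [a x y|]; first by rewrite !f0 scaler0 addr0.
  by exists 0 => x; rewrite mul0r f0 normr0.
move=> a f g fB gB; apply/bounded_linearP; split=> [b x y|].
  have [lf _] := bounded_linearP _ fB; have [lg _] := bounded_linearP _ gB.
  rewrite !fctE lf lg !scalerDr addrACA !scalerA [a * b]mulrC; congr (_ + _).
have [M M0 fM] := bounded_linear_ge0 fB.
have [N N0 gN] := bounded_linear_ge0 gB.
exists (`|a| * M + N) => x; rewrite !fctE.
by rewrite (le_trans (ler_normD _ _))// mulrDl lerD// normrZ -mulrA ler_wpM2l.
Qed.

HB.instance Definition _ :=
  GRing.isSubmodClosed.Build _ _ bounded_linear bounded_linear_submod.

(* B(V). *)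
Record bop := Bop {
  bop_fun :> V -> V;
  bop_bounded : bop_fun \in bounded_linear }.

HB.instance Definition _ := [isSub for bop_fun].
HB.instance Definition _ := [Choice of bop by <:].
HB.instance Definition _ := [SubChoice_isSubLmodule of bop by <:].

Implicit Types S T : bop.

Lemma bopP S T : S = T <-> S =1 T.
Proof. by split=> [->//|/funext] ST; apply: val_inj. Qed.

Lemma bop_linear T : linear T.
Proof. by have /bounded_linearP[] := bop_bounded T. Qed.

HB.instance Definition _ T :=
  GRing.isLinear.Build R[i] V V *:%R (bop_fun T) (bop_linear T).

Lemma bounded_linear_id : idfun \in bounded_linear.
Proof.
by apply/bounded_linearP; split=> //; exists 1 => x; rewrite mul1r.
Qed.

Lemma bounded_linear_comp S T : S \o T \in bounded_linear.
Proof.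
apply/bounded_linearP; split=> [a x y|]; first by rewrite /= !linearP.
have [M M0 SM] := bounded_linear_ge0 (bop_bounded S).
have [N N0 TN] := bounded_linear_ge0 (bop_bounded T).
by exists (M * N) => x; rewrite /= (le_trans (SM _))// -mulrA ler_wpM2l.
Qed.

Definition bop_one := Bop bounded_linear_id.
Definition bop_mul S T := Bop (bounded_linear_comp S T).

Lemma bop_mulA : associative bop_mul.
Proof. by move=> S T U; apply/bopP. Qed.

Lemma bop_mul1l : left_id bop_one bop_mul.
Proof. by move=> S; apply/bopP. Qed.

Lemma bop_mul1r : right_id bop_one bop_mul.
Proof. by move=> S; apply/bopP. Qed.

Lemma bop_mulDl : left_distributive bop_mul +%R.
Proof. by move=> S T U; apply/bopP. Qed.

Lemma bop_mulDr : right_distributive bop_mul +%R.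
Proof. by move=> S T U; apply/bopP => x; apply: (raddfD S). Qed.

(* Only a pzRingType, as 1 = 0 when V is trivial. *)
HB.instance Definition _ := GRing.Zmodule_isPzRing.Build bop
  bop_mulA bop_mul1l bop_mul1r bop_mulDl bop_mulDr.

Definition opnorm T : R[i] :=
  (sup [set rnorm (T x) | x in [set x | `|x| <= 1]])%:C.

Lemma opnorm_has_sup T :
  has_sup [set rnorm (T x) | x in [set x | `|x| <= 1]].
Proof.
split; first by exists (rnorm (T 0)), 0 => //=; rewrite normr0.
have [M M0 TM] := bounded_linear_ge0 (bop_bounded T).
exists (complex.Re M) => _ [x /= x1 <-]; rewrite -lecR rnormE RRe_real ?ger0_real//.
by rewrite (le_trans (TM x))// ler_piMr.
Qed.

Lemma opnorm_ub T x : `|x| <= 1 -> `|T x| <= opnorm T.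
Proof.
move=> x1; rewrite -rnormE lecR; apply: sup_upper_bound; last by exists x.
exact: opnorm_has_sup.
Qed.

Lemma opnorm_le T (M : R[i]) :
  (forall x, `|x| <= 1 -> `|T x| <= M) -> opnorm T <= M.
Proof.
move=> TM.
have M0 : 0 <= M by have := TM 0; rewrite linear0 !normr0; exact.
rewrite -[leRHS]RRe_real ?ger0_real// lecR ge_sup//; first by case: (opnorm_has_sup T).
by move=> _ [x /= x1 <-]; rewrite -lecR rnormE RRe_real ?ger0_real// TM.
Qed.

Lemma opnorm_ge0 T : 0 <= opnorm T.
Proof. by rewrite (le_trans _ (@opnorm_ub T 0 _))// normr0. Qed.

Lemma ler_opnorm T x : `|T x| <= opnorm T * `|x|.
Proof.
have [->|x0] := eqVneq x 0; first by rewrite linear0 !normr0 mulr0.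
rewrite -ler_pdivrMr ?normr_gt0// mulrC -[X in X * _]ger0_norm ?invr_ge0//.
rewrite -normrZ -linearZ opnorm_ub// normrZ ger0_norm ?invr_ge0//.
by rewrite mulVf// normr_eq0.
Qed.

Lemma opnormD S T : opnorm (S + T) <= opnorm S + opnorm T.
Proof.
by apply: opnorm_le => x x1; rewrite (le_trans (ler_normD _ _))// lerD ?opnorm_ub.
Qed.

Lemma opnormZ (a : R[i]) T : opnorm (a *: T) = `|a| * opnorm T.
Proof.
have le b S : opnorm (b *: S) <= `|b| * opnorm S.
  by apply: opnorm_le => x x1; rewrite normrZ ler_wpM2l ?opnorm_ub.
apply/le_anti; rewrite le/=.
have [->|a0] := eqVneq a 0; first by rewrite normr0 mul0r opnorm_ge0.
rewrite -ler_pdivlMl ?normr_gt0// -normfV -{1}[T]scale1r -(mulVf a0) -scalerA.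
exact: le.
Qed.

Lemma opnorm0_eq0 T : opnorm T = 0 -> T = 0.
Proof.
move=> T0; apply/bopP => x; apply/normr0_eq0/le_anti.
by rewrite normr_ge0 (le_trans (ler_opnorm T x))// T0 mul0r.
Qed.

HB.instance Definition _ :=
  Lmodule_isNormed.Build R[i] bop opnormD opnormZ opnorm0_eq0.

End bounded_operators.

Section operators.
Context {R : realType} {V : normedModType R[i]}.
Implicit Types (S T : bop V) (p : {poly R[i]}).

Definition op_inverse T S := T * S = 1 /\ S * T = 1.

Definition op_invertible T := exists S, op_inverse T S.

(* Here and below, [get] picks the element of a set that has exactly one. *)
Definition op_inv T : bop V := get (op_inverse T).

Definition spectrum T : set R[i] :=
  [set z | ~ op_invertible (T - z *: (1 : bop V))].

Definition spectral_radius T : R :=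
  sup [set rnorm (z : R[i]^o) | z in spectrum T].

Definition op_exp T : bop V :=
  limn (series (fun k => (k`!%:R^-1 : R[i]) *: T ^+ k)).

Definition op_poly p T : bop V := \sum_(i < size p) p`_i *: T ^+ i.

(* f(T) for self-adjoint T and f continuous on the spectrum of T: the limit of
   p_n(T) for any polynomials p_n converging to f uniformly on the spectrum. *)
Definition op_fun_calculus (f : R[i] -> R[i]^o) T : bop V :=
  get [set S : bop V | exists p : nat -> {poly R[i]},
    {uniform spectrum T, (fun n z => (p n).[z] : R[i]^o) @ \oo --> f} /\
    (fun n => op_poly (p n) T) @ \oo --> S].

(* T^a for positive T and a >= 0. As 0 `^ 0 = 1, T^0 = 1. *)
Definition op_power T (a : R) : bop V :=
  op_fun_calculus (fun z => (complex.Re z `^ a)%:C) T.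

End operators.

Section hilbert_operators.
Context {R : realType} {H : normedModType R[i]}.
(* [ip] is linear in its first argument, conjugate-linear in the second. *)
Variable ip : {dot H for (@Num.conj R[i])}.
Implicit Types (S T U : bop H).

Definition adjoint T : bop H :=
  get [set S : bop H | forall x y, ip (T x) y = ip x (S y)].

Definition selfadjoint T := adjoint T = T.

Definition numerical_range T : set R[i] :=
  [set ip (T x) x | x in [set x | `|x| = 1]].

Definition numerical_radius T : R :=
  sup [set rnorm (z : R[i]^o) | z in numerical_range T].

Definition op_abs T : bop H := op_power (adjoint T * T) 2^-1.

Definition op_ker T : set H := [set x | T x = 0].

Definition orthogonal_complement (A : set H) : set H :=
  [set x | forall y, A y -> ip x y = 0].

Definition partial_isometry U :=
  forall x, orthogonal_complement (op_ker U) x -> `|U x| = `|x|.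

Definition polar_isometry T : bop H :=
  get [set U : bop H |
    [/\ T = U * op_abs T, partial_isometry U & op_ker U = op_ker T]].

Definition aluthge (lambda : R) T : bop H :=
  op_power (op_abs T) lambda * polar_isometry T *
  op_power (op_abs T) (1 - lambda).

End hilbert_operators.

(* Main.v *)
(* Lower bound: if S = U|S|, a nonzero spectral value of S = (U |S|^(1-l)) |S|^l is one of
   Delta_l(S) = |S|^l (U |S|^(1-l)), and spectral values are bounded by the numerical radius.

   Upper bound: w(Delta_l^n(S)) <= |Delta_l^n(S)| <= |S|, so it suffices to find, for each c > r(T), a
   self-adjoint A with |e^A T e^-A| <= c. Some power satisfies |T^m| <= c^m, so that T / c is a contraction
   for the equivalent norm given by sum_(k < m) |(T / c)^k x|^2 = |X x|^2, and A = log X.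

   That |T^m| <= c^m for some m is obtained without complex analysis: (1 - s^n T^n)^-1 is the average of
   (1 - w s T)^-1 over the n-th roots of unity w (n a power of 2), so its modulus of continuity in s does not
   depend on n, and smallness of s^n T^n for large n propagates from s = 0 to s = 1 / c in finitely many steps.

   The functional calculus of a self-adjoint A rests on |p(A)| <= sup |p| over the spectrum, which follows from
   |p(A)|^2 <= |(conj(p) p)(A)| and from the fact that |B| or -|B| is a spectral value of a self-adjoint B. *)
Require Import Defs.
From HB Require Import structures.
From mathcomp Require Import all_boot all_order all_algebra sesquilinear.
From mathcomp Require Import complex.
From mathcomp Require Import all_classical all_reals all_analysis.
From mathcomp Require Import ring lra.

Set Implicit Arguments.
Unset Strict Implicit.
Unset Printing Implicit Defensive.

Import Order.TTheory GRing.Theory Num.Theory.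
Import numFieldNormedType.Exports.

Local Open Scope classical_set_scope.
Local Open Scope ring_scope.
Local Open Scope complex_scope.

(** * Real-valued norms and convergence *)

Section complex_norm.
Context {R : realType}.
Implicit Types (z : R[i]) (x : R).

(** The operators [op_exp A] with [A] self-adjoint are particular invertible operators, so one
    estimate in each direction serves both infima: the lower bound is proved for an arbitrary
    conjugation, the upper bound for [op_exp A] alone. That Delta_l does not increase the norm comes
    from | |S|^l | <= | |S| |^l and |U| <= 1, the exponents l and 1 - l adding up to 1. Adjoints,
    inverses, functions of an operator and polar isometries are values of [get], which say nothing
    until the set in question is shown to be inhabited; hence the Riesz theorem, a Weierstrass
    theorem and the polar decomposition on the way. Coercivity, itself reduced to the Neumann
    series, both locates the spectrum of a self-adjoint operator and bounds spectral values by the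
    numerical radius. The order of R[i] is only partial, so estimates are made with the real numbers
    [cnorm] and [rnorm], and limits are expressed through them. *)

Definition cnorm z : R := complex.Re `|z|.

Lemma cnormE z : (cnorm z)%:C = `|z|.
Proof. by rewrite /cnorm RRe_real// normr_real. Qed.

Lemma cnorm_ge0 z : 0 <= cnorm z.
Proof. by rewrite -lecR cnormE; exact: normr_ge0. Qed.

Lemma cnorm0 : cnorm 0 = 0.
Proof. by rewrite /cnorm normr0. Qed.

Lemma cnorm1 : cnorm 1 = 1.
Proof. by rewrite /cnorm normr1. Qed.

Lemma cnorm_eq0 z : cnorm z = 0 -> z = 0.
Proof. by move=> z0; apply/normr0_eq0; rewrite -cnormE z0. Qed.

Lemma cnormN z : cnorm (- z) = cnorm z.
Proof. by rewrite /cnorm normrN. Qed.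

Lemma cnormM z1 z2 : cnorm (z1 * z2) = cnorm z1 * cnorm z2.
Proof.
apply: complexI.
by rewrite rmorphM /= !cnormE normrM.
Qed.

Lemma cnormX z n : cnorm (z ^+ n) = cnorm z ^+ n.
Proof. by elim: n => [|n IH]; rewrite ?expr0 ?cnorm1// !exprS cnormM IH. Qed.

Lemma cnormV z : cnorm z^-1 = (cnorm z)^-1.
Proof.
have [->|z0] := eqVneq z 0; first by rewrite invr0 cnorm0 invr0.
have nz : cnorm z != 0 by apply: contra_neq z0; exact: cnorm_eq0.
by apply: (mulfI nz); rewrite -cnormM !divff// cnorm1.
Qed.

Lemma cnormD z1 z2 : cnorm (z1 + z2) <= cnorm z1 + cnorm z2.
Proof. by rewrite -lecR rmorphD /= !cnormE ler_normD. Qed.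

Lemma cnormB z1 z2 : cnorm (z1 - z2) <= cnorm z1 + cnorm z2.
Proof. by rewrite -[in leRHS](cnormN z2) cnormD. Qed.

Lemma cnorm_distC z1 z2 : cnorm (z1 - z2) = cnorm (z2 - z1).
Proof. by rewrite -cnormN opprB. Qed.

Lemma cnorm_real x : cnorm x%:C = `|x|.
Proof. by rewrite /cnorm normc_def /= expr0n addr0 sqrtr_sqr. Qed.

Lemma cnorm_nat n : cnorm n%:R = n%:R.
Proof. by rewrite -(rmorph_nat (real_complex R)) cnorm_real normr_nat. Qed.

Lemma sqr_cnorm z : cnorm z ^+ 2 = complex.Re z ^+ 2 + complex.Im z ^+ 2.
Proof. by apply: complexI; rewrite rmorphXn /= cnormE add_Re2_Im2. Qed.

Lemma cnorm_conj z : cnorm z^* = cnorm z.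
Proof. by rewrite /cnorm norm_conjC. Qed.

Lemma Re_conj z : complex.Re (Num.conj z) = complex.Re z.
Proof. by case: z. Qed.

Lemma Im_conj z : complex.Im (Num.conj z) = - complex.Im z.
Proof. by case: z. Qed.

Lemma conj_real x : Num.conj (x%:C : R[i]) = x%:C.
Proof. by apply/eqP; rewrite eq_complex Re_conj Im_conj /= oppr0 !eqxx. Qed.

Lemma Re_cnorm z : complex.Re z <= cnorm z.
Proof.
by rewrite (le_trans (ler_norm _))// -lecR cnormE normc_ge_Re.
Qed.

Lemma real_complexE z : complex.Im z = 0 -> z = (complex.Re z)%:C.
Proof. by case: z => a b /= ->. Qed.

Lemma conjM_cnorm z : Num.conj z * z = (cnorm z ^+ 2)%:C.
Proof. by rewrite mulrC -normCK rmorphXn /= cnormE. Qed.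

Lemma half_half (V : lmodType R[i]) (u : V) : (2^-1 : R[i]) *: (u + u) = u.
Proof. by rewrite -mulr2n -[u *+ 2]scaler_nat scalerA mulVf ?scale1r// pnatr_eq0. Qed.

End complex_norm.

Section real_norm.
Context {R : realType} {V : normedModType R[i]}.
Implicit Types x y : V.

Lemma rnorm_ge0 x : 0 <= rnorm x.
Proof. by rewrite -lecR rnormE; exact: normr_ge0. Qed.

Lemma rnorm0 : rnorm (0 : V) = 0.
Proof. by rewrite /rnorm normr0. Qed.

Lemma rnorm_eq0 x : rnorm x = 0 -> x = 0.
Proof. by move=> x0; apply/normr0_eq0; rewrite -rnormE x0. Qed.

Lemma rnorm_gt0 x : x != 0 -> 0 < rnorm x.
Proof.
by move=> x0; rewrite lt_def rnorm_ge0 andbT; apply: contra_neq x0; exact: rnorm_eq0.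
Qed.

Lemma rnormN x : rnorm (- x) = rnorm x.
Proof. by rewrite /rnorm normrN. Qed.

Lemma rnorm_distC x y : rnorm (x - y) = rnorm (y - x).
Proof. by rewrite -rnormN opprB. Qed.

Lemma rnormD x y : rnorm (x + y) <= rnorm x + rnorm y.
Proof. by rewrite -lecR rmorphD /= !rnormE ler_normD. Qed.

Lemma rnormB x y : rnorm (x - y) <= rnorm x + rnorm y.
Proof. by rewrite -[in leRHS](rnormN y) rnormD. Qed.

Lemma rnorm_triangle z x y : rnorm (x - y) <= rnorm (x - z) + rnorm (z - y).
Proof. by rewrite (le_trans _ (rnormD _ _))// addrA subrK. Qed.

Lemma rnormZ a x : rnorm (a *: x) = cnorm a * rnorm x.
Proof. by apply: complexI; rewrite rmorphM /= cnormE !rnormE normrZ. Qed.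

Lemma rnorm_eq_of_small x y : (forall e, 0 < e -> rnorm (x - y) <= e) -> x = y.
Proof.
move=> h; apply/eqP; rewrite -subr_eq0; apply/eqP/rnorm_eq0.
apply/le_anti; rewrite rnorm_ge0 andbT.
by apply/ler_addgt0Pr => e e0; rewrite add0r h.
Qed.

(** The threshold is a real number, whereas filter convergence in [V] quantifies over positive
    elements of R[i]; [tendsP] is the bridge. *)
Definition tends (u : nat -> V) (l : V) :=
  forall e : R, 0 < e -> exists N, forall n, (N <= n)%N -> rnorm (u n - l) <= e.

Definition cauchy_seq (u : nat -> V) :=
  forall e : R, 0 < e ->
  exists N, forall m n, (N <= m)%N -> (N <= n)%N -> rnorm (u m - u n) <= e.

Lemma tends_unique u l l' : tends u l -> tends u l' -> l = l'.
Proof.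
move=> ul ul'; apply: rnorm_eq_of_small => e e0.
have e2 : 0 < e / 2 by rewrite divr_gt0.
have [N hN] := ul _ e2; have [N' hN'] := ul' _ e2.
rewrite (le_trans (rnorm_triangle (u (maxn N N')) _ _))//.
rewrite [leRHS]splitr lerD//; last by rewrite hN'// leq_maxr.
by rewrite rnorm_distC hN// leq_maxl.
Qed.

Lemma tends_cauchy u l : tends u l -> cauchy_seq u.
Proof.
move=> ul e e0; have [N hN] := ul _ (divr_gt0 e0 (ltr0n R 2)).
exists N => m n Nm Nn; rewrite (le_trans (rnorm_triangle l _ _))//.
by rewrite [leRHS]splitr lerD// ?hN// rnorm_distC hN.
Qed.

Lemma tendsP u l : tends u l <-> u @ \oo --> l.
Proof.
split=> [ul|/cvgrPdist_lt ul e e0].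
  apply/cvgrPdist_lt => e e0.
  have e0' : 0 < complex.Re e / 2 by rewrite divr_gt0// -ltcR RRe_real ?gtr0_real.
  have [N hN] := ul _ e0'.
  exists N => // n /= Nn; rewrite distrC -rnormE -(RRe_real (gtr0_real e0)) ltcR.
  by rewrite (le_lt_trans (hN _ Nn))// ltr_pdivrMr// ltr_pMr ?ltr1n// -ltcR RRe_real ?gtr0_real.
have [|N _ hN] := ul e%:C; first by rewrite ltcR.
by exists N => n Nn; rewrite -lecR rnormE distrC ltW// hN.
Qed.

Lemma tendsD u v l m : tends u l -> tends v m -> tends (fun n => u n + v n) (l + m).
Proof. by move=> /tendsP ul /tendsP vm; apply/tendsP; exact: cvgD. Qed.

Lemma tends_cst l : tends (fun=> l) l.
Proof. by move=> e e0; exists 0%N => n _; rewrite subrr rnorm0 ltW. Qed.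

Lemma tendsZ a u l : tends u l -> tends (fun n => a *: u n) (a *: l).
Proof.
move=> ul e e0; have c0 := cnorm_ge0 a.
have [N hN] := ul (e / (cnorm a + 1)) ltac:(apply: divr_gt0 => //; lra).
exists N => n Nn; rewrite -scalerBr rnormZ.
have := hN _ Nn; rewrite ler_pdivlMr; last lra.
by have := rnorm_ge0 (u n - l); nra.
Qed.

Lemma tends_eq u v l : u =1 v -> tends u l -> tends v l.
Proof. by move=> /funext ->. Qed.

End real_norm.

Section complete.
Context {R : realType} {H : completeNormedModType R[i]}.

Lemma cauchy_tends (u : nat -> H) : cauchy_seq u -> exists l, tends u l.
Proof.
move=> cu; exists (lim (u @ \oo)); apply/tendsP.
apply: cauchy_cvg; apply/cauchy_ballP => e e0.
have e0' : 0 < complex.Re e / 2 by rewrite divr_gt0// -ltcR RRe_real ?gtr0_real.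
have [N hN] := cu _ e0'.
exists (u @` [set n | (N <= n)%N], u @` [set n | (N <= n)%N]) => /=.
  by split; exists N => // n /= Nn; exists n.
move=> [_ _] /= [[m Nm <-] [n Nn <-]]; rewrite -ball_normE /= -rnormE -(RRe_real (gtr0_real e0)) ltcR.
by rewrite (le_lt_trans (hN _ _ Nm Nn))// ltr_pdivrMr// ltr_pMr ?ltr1n// -ltcR RRe_real ?gtr0_real.
Qed.

End complete.

(** * The algebra of bounded operators *)

Section bop_algebra.
Context {R : realType} {V : normedModType R[i]}.
Implicit Types (S T U : bop V) (x y : V) (a z : R[i]).

Lemma bop_addE S T x : (S + T) x = S x + T x. Proof. by []. Qed.
Lemma bop_oppE S x : (- S) x = - S x. Proof. by []. Qed.
Lemma bop_scaleE a S x : (a *: S) x = a *: S x. Proof. by []. Qed.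
Lemma bop_mulE S T x : (S * T) x = S (T x). Proof. by []. Qed.
Lemma bop_oneE x : (1 : bop V) x = x. Proof. by []. Qed.
Lemma bop_zeroE x : (0 : bop V) x = 0. Proof. by []. Qed.

Lemma bop_subE S T x : (S - T) x = S x - T x. Proof. by []. Qed.

Lemma bop_sumE I (r : seq I) (F : I -> bop V) x :
  (\sum_(i <- r) F i) x = \sum_(i <- r) F i x.
Proof. by elim/big_rec2: _ => // i y S _ <-. Qed.

Definition bopE := (bop_subE, bop_addE, bop_oppE, bop_scaleE, bop_mulE, bop_oneE, bop_zeroE).

Lemma bop_scaleAl a S T : (a *: S) * T = a *: (S * T).
Proof. exact/bopP. Qed.

Lemma bop_scaleAr a S T : S * (a *: T) = a *: (S * T).
Proof. by apply/bopP => x; rewrite !bopE linearZ. Qed.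

Lemma bop_scale_mul a b S T : (a *: S) * (b *: T) = (a * b) *: (S * T).
Proof. by rewrite bop_scaleAl bop_scaleAr scalerA. Qed.

Lemma bop_exprZ a S n : (a *: S) ^+ n = a ^+ n *: S ^+ n.
Proof.
elim: n => [|n IH]; first by rewrite !expr0 scale1r.
by rewrite !exprS IH bop_scale_mul.
Qed.

Lemma rnorm_apply T x : rnorm (T x) <= rnorm T * rnorm x.
Proof. by rewrite -lecR rmorphM /= !rnormE; exact: ler_opnorm. Qed.

Lemma rnorm_bop_le T M : 0 <= M -> (forall x, rnorm (T x) <= M * rnorm x) -> rnorm T <= M.
Proof.
move=> M0 TM; rewrite -lecR rnormE; apply: opnorm_le => x x1.
rewrite -rnormE lecR (le_trans (TM x))// ler_piMr//.
by rewrite -lecR rnormE.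
Qed.

Lemma rnorm_mul S T : rnorm (S * T) <= rnorm S * rnorm T.
Proof.
apply: rnorm_bop_le => [|x]; first by rewrite mulr_ge0 ?rnorm_ge0.
by rewrite bop_mulE (le_trans (rnorm_apply _ _))// -mulrA ler_wpM2l ?rnorm_ge0 ?rnorm_apply.
Qed.

Lemma rnorm_bop1 : rnorm (1 : bop V) <= 1.
Proof. by apply: rnorm_bop_le => // x; rewrite mul1r. Qed.

Lemma rnorm_exp T n : rnorm (T ^+ n) <= rnorm T ^+ n.
Proof.
elim: n => [|n IH]; first by rewrite !expr0 rnorm_bop1.
by rewrite !exprS (le_trans (rnorm_mul _ _))// ler_wpM2l ?rnorm_ge0.
Qed.

Lemma bop_of (f : V -> V) M : linear f -> (forall x, rnorm (f x) <= M * rnorm x) ->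
  exists T : bop V, forall x, T x = f x.
Proof.
move=> lf fM; have fB : f \in @bounded_linear R V.
  apply/bounded_linearP; split=> //; exists M%:C => x.
  by rewrite -!rnormE -rmorphM lecR.
by exists (Bop fB).
Qed.

Lemma tendsM (S_ T_ : nat -> bop V) S T : tends S_ S -> tends T_ T -> tends (fun n => S_ n * T_ n : bop V) (S * T).
Proof.
move=> SS TT e e0.
pose K := rnorm S + rnorm T + 1.
have K1 : 1 <= K by rewrite lerDr addr_ge0 ?rnorm_ge0.
have K0 : 0 < K by rewrite (lt_le_trans _ K1).
pose d := Num.min 1 (e / (2 * K)).
have d0 : 0 < d by rewrite lt_min ltr01 divr_gt0// mulr_gt0.
have [N hN] := SS _ d0; have [N' hN'] := TT _ d0.
exists (maxn N N') => n; rewrite geq_max => /andP[/hN Sn /hN' Tn].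
have -> : S_ n * T_ n - S * T = (S_ n - S) * T_ n + S * (T_ n - T).
  by rewrite mulrBl mulrBr addrA subrK.
have d1 : d <= 1 by rewrite ge_min lexx.
have dK : d * (2 * K) <= e by rewrite -ler_pdivlMr ?mulr_gt0// ge_min lexx orbT.
have Tn1 : rnorm (T_ n) <= rnorm T + 1.
  by rewrite -[T_ n](subrK T) (le_trans (rnormD _ _))// addrC lerD2l (le_trans Tn).
rewrite (le_trans (rnormD _ _))//.
have h1 := rnorm_mul (S_ n - S) (T_ n); have h2 := rnorm_mul S (T_ n - T).
have := rnorm_ge0 S; have := rnorm_ge0 T; have := rnorm_ge0 (S_ n - S).
have := rnorm_ge0 (T_ n - T); have := rnorm_ge0 (T_ n); rewrite /K in dK *.
nra.
Qed.

Lemma tends_bop T u l : tends u l -> tends (fun n => T (u n)) (T l).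
Proof.
move=> ul e e0; have x0 := rnorm_ge0 T.
have [N hN] := ul (e / (rnorm T + 1)) ltac:(apply: divr_gt0 => //; lra).
exists N => n Nn; rewrite -linearB (le_trans (rnorm_apply _ _))//.
have := hN _ Nn; rewrite ler_pdivlMr; last lra.
by have := rnorm_ge0 (u n - l); nra.
Qed.

Lemma op_inverse_unique T S S' : op_inverse T S -> op_inverse T S' -> S = S'.
Proof. by move=> [_ ST] [TS' _]; rewrite -[S]mulr1 -TS' mulrA ST mul1r. Qed.

Lemma op_invE T S : op_inverse T S -> op_inv T = S.
Proof.
move=> TS; have TI : op_inverse T (op_inv T) by apply: getPex; exists S.
exact: op_inverse_unique TI TS.
Qed.

Lemma op_invP T : op_invertible T -> op_inverse T (op_inv T).
Proof. by move=> [S TS]; rewrite (op_invE TS). Qed.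

Lemma op_invertible1 : op_invertible (1 : bop V).
Proof. by exists 1; split; rewrite mulr1. Qed.

Lemma op_inverseM T T' S S' : op_inverse T S -> op_inverse T' S' ->
  op_inverse (T * T') (S' * S).
Proof.
move=> [a b] [c d]; split.
  by rewrite mulrA -(mulrA T) c mulr1.
by rewrite mulrA -(mulrA S') b mulr1.
Qed.

Lemma op_invertibleM T T' : op_invertible T -> op_invertible T' -> op_invertible (T * T').
Proof. by move=> [S hS] [S' hS']; exists (S' * S); exact: op_inverseM. Qed.

Lemma op_invertibleZ a T : a != 0 -> op_invertible T -> op_invertible (a *: T).
Proof.
move=> a0 [S [h1 h2]]; exists (a^-1 *: S).
by split; rewrite bop_scale_mul ?h1 ?h2 ?divff ?mulVf ?scale1r.
Qed.

Lemma op_invertibleZ_iff a T : a != 0 -> op_invertible (a *: T) <-> op_invertible T.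
Proof.
move=> a0; split; last exact: op_invertibleZ.
move/(op_invertibleZ (invr_neq0 a0)).
by rewrite scalerA mulVf// scale1r.
Qed.

(* Jacobson's lemma: [1 + B (1 - A B)^-1 A] inverts [1 - B A]. *)
Lemma invertible_1BmulC A B : op_invertible (1 - A * B : bop V) -> op_invertible (1 - B * A : bop V).
Proof.
move=> [G [h1 h2]]; exists (1 + B * G * A).
have e1 : A * B * G = G - 1 by rewrite -h1 mulrBl mul1r opprB addrC subrK.
have e2 : G * (A * B) = G - 1 by rewrite -h2 mulrBr mulr1 opprB addrC subrK.
split.
  rewrite mulrDr mulr1 mulrBl mul1r.
  have -> : B * A * (B * G * A) = B * (A * B * G) * A by rewrite !mulrA.
  by rewrite e1 mulrBr mulr1 mulrBl subKr subrK.
rewrite mulrDl mul1r mulrBr mulr1.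
have -> : B * G * A * (B * A) = B * (G * (A * B)) * A by rewrite !mulrA.
by rewrite e2 mulrBr mulr1 mulrBl subKr subrK.
Qed.

(** For nonzero [z], C - z is -z times 1 - z^-1 C, so Jacobson's lemma applies to the factors z^-1 B
    and A. *)
Lemma spectrum_mulC A B z : z != 0 -> spectrum (A * B : bop V) z -> spectrum (B * A : bop V) z.
Proof.
move=> z0; rewrite /spectrum /=; apply: contra_not.
have sE (C : bop V) : C - z *: (1 : bop _) = (- z) *: (1 - z^-1 *: C).
  by rewrite scalerBr scalerA mulNr divff// scaleN1r opprK scaleNr addrC.
have nz0 : - z != 0 by rewrite oppr_eq0.
rewrite !sE !op_invertibleZ_iff//.
by rewrite -bop_scaleAl => /invertible_1BmulC; rewrite bop_scaleAr.
Qed.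

Lemma spectrum_conj X Y T z : op_inverse X Y -> spectrum T z -> spectrum (X * T * Y) z.
Proof.
move=> [h1 h2] Tz inv; apply: Tz.
have -> : T - z *: (1 : bop _) = Y * (X * T * Y - z *: (1 : bop V)) * X.
  rewrite mulrBr mulrBl bop_scaleAr mulr1 bop_scaleAl h2; congr (_ - _).
  by rewrite !mulrA h2 mul1r -mulrA h2 mulr1.
by apply: op_invertibleM => //; [apply: op_invertibleM => //; exists X|exists Y].
Qed.

Lemma op_polyE (p : {poly R[i]}) T n : (size p <= n)%N ->
  op_poly p T = \sum_(i < n) p`_i *: T ^+ i.
Proof.
move=> pn; rewrite -(subnKC pn) big_split_ord /= [X in _ + X]big1 ?addr0// => i _.
by rewrite nth_default ?scale0r// leq_addr.
Qed.

Lemma op_polyD p q T : op_poly (p + q) T = op_poly p T + op_poly q T.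
Proof.
pose n := maxn (size p) (size q).
rewrite (@op_polyE p _ n) ?leq_maxl// (@op_polyE q _ n) ?leq_maxr//.
rewrite (@op_polyE _ _ n); last exact: size_polyD.
by rewrite -big_split; apply: eq_bigr => i _; rewrite coefD scalerDl.
Qed.

Lemma op_polyZ a p T : op_poly (a *: p) T = a *: op_poly p T.
Proof.
rewrite (@op_polyE _ _ (size p)) ?size_scale_leq// /op_poly scaler_sumr.
by apply: eq_bigr => i _; rewrite coefZ scalerA.
Qed.

Lemma op_polyB p q T : op_poly (p - q) T = op_poly p T - op_poly q T.
Proof. by rewrite op_polyD -scaleN1r op_polyZ scaleN1r. Qed.

Lemma op_polyC a T : op_poly a%:P T = a *: (1 : bop V).
Proof. by rewrite (@op_polyE _ _ 1) ?size_polyC ?leq_b1// big_ord1 coefC. Qed.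

Lemma op_polyMX p T : op_poly (p * 'X) T = op_poly p T * T.
Proof.
rewrite (@op_polyE _ _ (size p).+1); last first.
  by rewrite (leq_trans (size_polyMleq _ _))// size_polyX addn2.
rewrite big_ord_recl coefMX /= scale0r add0r /op_poly mulr_suml.
by apply: eq_bigr => i _; rewrite coefMX /= bop_scaleAl exprSr.
Qed.

Lemma op_polyX T : op_poly 'X T = T.
Proof. by rewrite -['X]mul1r op_polyMX -polyC1 op_polyC scale1r mul1r. Qed.

Lemma op_poly_comm p T : op_poly p T * T = T * op_poly p T.
Proof.
rewrite /op_poly mulr_suml mulr_sumr; apply: eq_bigr => i _.
by rewrite bop_scaleAl bop_scaleAr -exprSr -exprS.
Qed.

Lemma op_polyM p q T : op_poly (p * q) T = op_poly p T * op_poly q T.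
Proof.
elim/poly_ind: q => [|q c IH].
  by rewrite mulr0 -(scale0r (0 : {poly _})) op_polyZ scale0r mulr0.
rewrite mulrDr mulrA !op_polyD !op_polyMX IH mulrDr mulrA; congr (_ + _).
by rewrite mulrC mul_polyC op_polyZ op_polyC bop_scaleAr mulr1.
Qed.

Lemma op_poly_prod (I : Type) (r : seq I) (F : I -> {poly R[i]}) T :
  op_poly (\prod_(i <- r) F i) T = \prod_(i <- r) op_poly (F i) T.
Proof.
elim: r => [|i r IH]; first by rewrite !big_nil -polyC1 op_polyC scale1r.
by rewrite !big_cons op_polyM IH.
Qed.

(** Half of the spectral mapping theorem: over an algebraically closed field [p] splits, and if
    every factor T - z were invertible, so would be their product. *)
Lemma op_poly_root p T : p != 0 -> ~ op_invertible (op_poly p T) ->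
  exists2 z, spectrum T z & p.[z] = 0.
Proof.
move=> p0 ni; have [rs prs] := closed_field_poly_normal p.
apply: contrapT => no; apply: ni; rewrite prs op_polyZ.
apply: op_invertibleZ; first by rewrite lead_coef_eq0.
rewrite op_poly_prod.
have : forall z, z \in rs -> p.[z] = 0.
  by move=> z zrs; apply/eqP; rewrite prs -/(root _ _) rootZ ?lead_coef_eq0// root_prod_XsubC.
elim: rs {prs} => [|z rs IH] hz; first by rewrite big_nil; exact: op_invertible1.
rewrite big_cons; apply: op_invertibleM; last first.
  by apply: IH => w wrs; apply: hz; rewrite inE wrs orbT.
rewrite op_polyB op_polyX op_polyC; apply: contrapT => ni; apply: no.
by exists z => //; apply: hz; rewrite mem_head.
Qed.

End bop_algebra.

Section bop_complete.
Context {R : realType} {H : completeNormedModType R[i]}.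
Implicit Types (S T : bop H) (x y : H).

(** The limit is taken pointwise. Letting one index of the Cauchy estimate go to infinity at each
    [x] gives a bound e |x| whose rank does not depend on [x], hence boundedness of the limit and
    convergence in norm. *)
Lemma bop_cauchy_tends (T_ : nat -> bop H) : cauchy_seq T_ -> exists T, tends T_ T.
Proof.
move=> cT.
have cTx x : exists l, tends (fun n => T_ n x) l.
  apply: cauchy_tends => e e0; have x0 := rnorm_ge0 x.
  have [N hN] := cT (e / (rnorm x + 1)) ltac:(apply: divr_gt0 => //; lra).
  exists N => m n Nm Nn; rewrite -bop_subE (le_trans (rnorm_apply _ _))//.
  have := hN _ _ Nm Nn; rewrite ler_pdivlMr; last lra.
  by have := rnorm_ge0 (T_ m - T_ n); nra.
have [f hf] := choice cTx.
have lf : linear f.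
  move=> a x y; apply: (@tends_unique _ _ (fun n => T_ n (a *: x + y))) => //.
  apply: tends_eq (tendsD (tendsZ a (hf x)) (hf y)) => n.
  by rewrite linearP.
have fT e : 0 < e -> exists N, forall n, (N <= n)%N -> forall x, rnorm (T_ n x - f x) <= e * rnorm x.
  move=> e0; have [N hN] := cT _ e0; exists N => n Nn x.
  apply/ler_addgt0Pr => d d0; have [N' hN'] := hf x _ d0.
  rewrite (le_trans (rnorm_triangle (T_ (maxn N N') x) _ _))// lerD//; last first.
    by rewrite hN'// leq_maxr.
  rewrite -bop_subE (le_trans (rnorm_apply _ _))// ler_wpM2r ?rnorm_ge0//.
  by rewrite hN// leq_maxl.
have [N hN] := fT 1 ltr01.
have [x|T TE] := @bop_of _ _ f (1 + rnorm (T_ N)) lf.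
  rewrite -[f x](subrK (T_ N x)) (le_trans (rnormD _ _))// mulrDl lerD ?rnorm_apply//.
  by rewrite rnorm_distC hN.
exists T => e e0; have [N' hN'] := fT _ e0; exists N' => n N'n.
by apply: rnorm_bop_le => [|x]; [exact: ltW|rewrite bop_subE TE hN'].
Qed.

Lemma neumann (S : bop H) : rnorm S < 1 -> op_invertible (1 - S).
Proof.
move=> S1; have S0 := rnorm_ge0 S.
pose u n := \sum_(i < n) S ^+ i.
have uS n : u n * (1 - S) = 1 - S ^+ n.
  elim: n => [|n IH]; first by rewrite /u big_ord0 mul0r expr0 subrr.
  rewrite /u big_ord_recr /= -/(u n) mulrDl IH mulrBr mulr1 -exprSr.
  by rewrite addrA subrK.
have Su n : (1 - S) * u n = 1 - S ^+ n.
  rewrite -uS /u mulr_suml mulr_sumr; apply: eq_bigr => i _.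
  by rewrite mulrBl mulrBr mulr1 mul1r -exprS exprSr.
have St : tends (fun n => S ^+ n) 0.
  move=> e e0.
  have : (fun n => rnorm S ^+ n) @ \oo --> (0 : R) by apply: cvg_expr; rewrite ger0_norm.
  move/cvgrPdist_le => /(_ _ e0) [N _ hN]; exists N => n Nn.
  rewrite subr0 (le_trans (rnorm_exp _ _))//.
  by have := hN _ Nn; rewrite sub0r normrN ger0_norm// exprn_ge0.
have ub n m : rnorm (u (n + m)%N - u n) * (1 - rnorm S) <= 2 * rnorm S ^+ n.
  have -> : u (n + m)%N - u n = S ^+ n * u m.
    rewrite /u big_split_ord /= addrAC subrr add0r mulr_sumr.
    by apply: eq_bigr => i _; rewrite exprD.
  (* From u_m = (1 - S^m) + u_m S: moving the last term to the left bounds all partial sums at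
     once. *)
  have um : rnorm (u m) * (1 - rnorm S) <= 2.
    have : rnorm (u m) <= 1 + rnorm S ^+ m + rnorm (u m) * rnorm S.
      have {1}-> : u m = (1 - S ^+ m) + u m * S.
        by rewrite -uS mulrBr mulr1 subrK.
      rewrite (le_trans (rnormD _ _))// lerD ?rnorm_mul//.
      by rewrite (le_trans (rnormB _ _))// lerD ?rnorm_bop1 ?rnorm_exp.
    have : rnorm S ^+ m <= 1 by rewrite exprn_ile1// ltW.
    lra.
  have h1 := le_trans (rnorm_mul (S ^+ n) (u m)) (ler_wpM2r (rnorm_ge0 _) (rnorm_exp S n)).
  have h2 : 0 <= rnorm S ^+ n by rewrite exprn_ge0.
  have := rnorm_ge0 (u m); nra.
have cu : cauchy_seq u.
  move=> e e0.
  have K0 : 0 < 1 - rnorm S by rewrite subr_gt0.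
  have : (fun n => rnorm S ^+ n) @ \oo --> (0 : R) by apply: cvg_expr; rewrite ger0_norm.
  move/cvgrPdist_le => /(_ _ (divr_gt0 (mulr_gt0 e0 K0) (ltr0n R 4))) [N _ /(_ N (leqnn N))].
  rewrite sub0r normrN ger0_norm ?exprn_ge0// ler_pdivlMr// => hN.
  have hn n : (N <= n)%N -> rnorm (u n - u N) <= e / 2.
    move=> Nn; have := ub N (n - N)%N; rewrite subnKC// => h.
    rewrite -(ler_pM2r K0) (le_trans h)//; lra.
  exists N => m n Nm Nn; rewrite (le_trans (rnorm_triangle (u N) _ _))//.
  by rewrite [leRHS]splitr lerD ?hn// rnorm_distC hn.
have [G uG] := bop_cauchy_tends cu.
have lim1 : tends (fun n => 1 - S ^+ n) (1 : bop H).
  have := tendsD (tends_cst (1 : bop H)) (tendsZ (-1) St); rewrite scaler0 addr0.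
  by apply: tends_eq => n; rewrite scaleN1r.
exists G; split.
  apply: (tends_unique _ lim1); apply: tends_eq (tendsM (tends_cst (1 - S : bop H)) uG) => n.
  exact: Su.
apply: (tends_unique _ lim1); apply: tends_eq (tendsM uG (tends_cst (1 - S : bop H))) => n.
exact: uS.
Qed.

Lemma spectrum_bound T z : spectrum T z -> cnorm z <= rnorm T.
Proof.
move=> Tz; rewrite leNgt; apply/negP => zT; apply: Tz.
have z0' : 0 < cnorm z by rewrite (le_lt_trans _ zT) ?rnorm_ge0.
have z0 : z != 0 by apply: contraTneq z0' => ->; rewrite cnorm0 ltxx.
have -> : T - z *: (1 : bop _) = (- z) *: (1 - z^-1 *: T).
  by rewrite scalerBr scalerA mulNr divff// scaleN1r opprK scaleNr addrC.
apply: op_invertibleZ; first by rewrite oppr_eq0.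
by apply: neumann; rewrite rnormZ cnormV mulrC ltr_pdivrMr// mul1r.
Qed.

Lemma spectral_radius_has_ub T : has_ubound [set rnorm (z : R[i]^o) | z in spectrum T].
Proof. by exists (rnorm T) => _ [z Tz <-]; exact: spectrum_bound. Qed.

Lemma spectrum_le_radius T z : spectrum T z -> cnorm z <= spectral_radius T.
Proof.
by move=> Tz; apply: sup_upper_bound; [split; [exists (cnorm z)|exact: spectral_radius_has_ub]|]; exists z.
Qed.

Lemma spectral_radius_ge0 T : 0 <= spectral_radius T.
Proof.
have [[z Tz]|no] := pselect (exists z, spectrum T z).
  by rewrite (le_trans (cnorm_ge0 z))// spectrum_le_radius.
(* On an empty spectrum [sup] takes its default value 0. *)
rewrite /spectral_radius sup_out// => -[[_ [z Tz _]] _].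
by apply: no; exists z.
Qed.

Lemma spectral_radius_le T M : 0 <= M -> (forall z, spectrum T z -> cnorm z <= M) ->
  spectral_radius T <= M.
Proof.
move=> M0 h; have [[z Tz]|no] := pselect (exists z, spectrum T z).
  by apply: ge_sup => [|_ [w Tw <-]]; [exists (cnorm z), z|exact: h].
rewrite /spectral_radius sup_out// => -[[_ [z Tz _]] _].
by apply: no; exists z.
Qed.

End bop_complete.

(** * Hilbert space geometry and adjoints *)

Section hilbert.
Context {R : realType} {H : completeNormedModType R[i]}.
Variable ip : {dot H for (@Num.conj R[i])}.
Hypothesis ip_norm : forall x : H, `|x| ^+ 2 = ip x x.
Implicit Types (x y z : H) (S T A B P : bop H) (a c : R[i]).

Lemma ipDl x y z : ip (x + y) z = ip x z + ip y z.
Proof. exact: linearDl. Qed.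

Lemma ipDr x y z : ip x (y + z) = ip x y + ip x z.
Proof. exact: linearDr. Qed.

Lemma ipNl x y : ip (- x) y = - ip x y.
Proof. exact: linearNl. Qed.

Lemma ipNr x y : ip x (- y) = - ip x y.
Proof. exact: linearNr. Qed.

Lemma ipBl x y z : ip (x - y) z = ip x z - ip y z.
Proof. by rewrite ipDl ipNl. Qed.

Lemma ipBr x y z : ip x (y - z) = ip x y - ip x z.
Proof. by rewrite ipDr ipNr. Qed.

Lemma ipZl a x y : ip (a *: x) y = a * ip x y.
Proof. exact: linearZl_LR. Qed.

Lemma ipZr a x y : ip x (a *: y) = Num.conj a * ip x y.
Proof. exact: linearZr_LR. Qed.

Lemma ip0l y : ip 0 y = 0. Proof. exact: linear0l. Qed.
Lemma ip0r y : ip y 0 = 0. Proof. exact: linear0r. Qed.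

Lemma ip_conj x y : ip y x = Num.conj (ip x y).
Proof. by rewrite hermC expr0 mul1r. Qed.

Lemma ipxx x : ip x x = (rnorm x ^+ 2)%:C.
Proof. by rewrite -ip_norm rmorphXn /= rnormE. Qed.

Lemma sqr_rnorm x : rnorm x ^+ 2 = complex.Re (ip x x).
Proof. by rewrite ipxx. Qed.

Lemma sqr_rnormD x y :
  rnorm (x + y) ^+ 2 = rnorm x ^+ 2 + rnorm y ^+ 2 + 2 * complex.Re (ip x y).
Proof.
rewrite !sqr_rnorm ipDl !ipDr !raddfD /= [ip y x]ip_conj Re_conj; ring.
Qed.

Lemma sqr_rnormB x y :
  rnorm (x - y) ^+ 2 = rnorm x ^+ 2 + rnorm y ^+ 2 - 2 * complex.Re (ip x y).
Proof. by rewrite sqr_rnormD rnormN ipNr raddfN /= mulrN. Qed.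

(** Pythagoras for the projection of [x] on the line of [y]. A left side that is nonnegative gives
    Cauchy-Schwarz; one that is at least |x|^2 gives [min_norm_orth]. *)
Lemma sqr_rnorm_proj x y : y != 0 ->
  rnorm (x - (ip x y / (rnorm y ^+ 2)%:C) *: y) ^+ 2 =
    rnorm x ^+ 2 - cnorm (ip x y) ^+ 2 / rnorm y ^+ 2.
Proof.
move=> y0; have ry := rnorm_gt0 y0.
have ry2 : 0 < rnorm y ^+ 2 by rewrite exprn_gt0.
rewrite sqr_rnormB rnormZ ipZr cnormM cnormV cnorm_real (gtr0_norm ry2).
have -> : Num.conj (ip x y / (rnorm y ^+ 2)%:C) * ip x y = (cnorm (ip x y) ^+ 2 / rnorm y ^+ 2)%:C.
  rewrite [RHS]rmorphM /= fmorphV /= -conjM_cnorm.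
  by rewrite (rmorphM (@Num.conj R[i])) /= fmorphV /= conj_real mulrAC.
rewrite /=.
by field; rewrite gt_eqF.
Qed.

Lemma cauchy_schwarz x y : cnorm (ip x y) <= rnorm x * rnorm y.
Proof.
have [->|y0] := eqVneq y 0; first by rewrite ip0r cnorm0 rnorm0 mulr0.
have ry := rnorm_gt0 y0.
rewrite -(@ler_pXn2r _ 2)// ?nnegrE ?cnorm_ge0 ?mulr_ge0 ?rnorm_ge0//.
rewrite exprMn -ler_pdivrMr ?exprn_gt0// -subr_ge0 -sqr_rnorm_proj//.
by rewrite exprn_ge0// rnorm_ge0.
Qed.

Lemma Re_ip_le x y : complex.Re (ip x y) <= rnorm x * rnorm y.
Proof. exact: le_trans (Re_cnorm _) (cauchy_schwarz x y). Qed.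

Lemma ip_eq0 x : (forall y, ip y x = 0) -> x = 0.
Proof.
move=> h; apply: rnorm_eq0; apply/eqP; rewrite -sqrf_eq0 sqr_rnorm h.
by rewrite eqxx.
Qed.

Lemma tends_ip (u v : nat -> H) x y : tends u x -> tends v y ->
  forall e : R, 0 < e -> exists N, forall n, (N <= n)%N -> cnorm (ip (u n) (v n) - ip x y) <= e.
Proof.
move=> ux vy e e0.
have x0 := rnorm_ge0 x; have y0 := rnorm_ge0 y.
have K0 : 0 < rnorm x + rnorm y + 1 by lra.
pose d := Num.min 1 (e / (rnorm x + rnorm y + 1)).
have d0 : 0 < d by rewrite lt_min ltr01 divr_gt0.
have d1 : d <= 1 by rewrite ge_min lexx.
have dK : d * (rnorm x + rnorm y + 1) <= e by rewrite -ler_pdivlMr// ge_min lexx orbT.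
have [N hN] := ux _ d0; have [N' hN'] := vy _ d0.
exists (maxn N N') => n; rewrite geq_max => /andP[/hN un /hN' vn].
have -> : ip (u n) (v n) - ip x y = ip (u n - x) (v n) + ip x (v n - y).
  by rewrite ipBl ipBr addrA subrK.
have vn1 : rnorm (v n) <= rnorm y + d.
  by rewrite -[v n](subrK y) (le_trans (rnormD _ _))// addrC lerD2l.
have h1 := cauchy_schwarz (u n - x) (v n); have h2 := cauchy_schwarz x (v n - y).
rewrite (le_trans (cnormD _ _))//.
have := rnorm_ge0 (u n - x); have := rnorm_ge0 (v n - y); have := rnorm_ge0 (v n); nra.
Qed.

Lemma tends_ip_eq (u v : nat -> H) x y c : tends u x -> tends v y ->
  (forall n, ip (u n) (v n) = c) -> ip x y = c.
Proof.
move=> ux vy h; apply/eqP; rewrite -subr_eq0; apply/eqP/cnorm_eq0/le_anti.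
rewrite cnorm_ge0 andbT; apply/ler_addgt0Pr => e e0; rewrite add0r.
by have [N /(_ N (leqnn N))] := tends_ip ux vy e0; rewrite h cnorm_distC.
Qed.

(* For small real [t > 0] coercivity gives [|1 - t B| < 1], so [t B] is invertible by Neumann. *)
Lemma coercive_invertible B (d : R) : 0 < d ->
  (forall x, d * rnorm x ^+ 2 <= complex.Re (ip (B x) x)) -> op_invertible B.
Proof.
move=> d0 hB; have B0 := rnorm_ge0 B.
pose M := rnorm B + d; have M0 : 0 < M by rewrite /M; lra.
(* In |x - t B x|^2 <= (1 - 2 t d + t^2 M^2) |x|^2 this choice makes t^2 M^2 = t d and leaves the
   factor 1 - t d, which is nonnegative because M >= d. *)
pose t := d / M ^+ 2; have t0 : 0 < t by rewrite divr_gt0// exprn_gt0.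
have tM : t * M ^+ 2 = d by rewrite /t divfK// expf_neq0// gt_eqF.
have td : t * d <= 1.
  rewrite /t mulrAC ler_pdivrMr ?exprn_gt0// mul1r -expr2.
  by rewrite ler_pXn2r// ?nnegrE /M; lra.
have q0 : 0 <= 1 - t * d by lra.
have tc : t%:C != 0 :> R[i] by rewrite fmorph_eq0 gt_eqF.
apply/(op_invertibleZ_iff _ tc).
have -> : t%:C *: B = 1 - (1 - t%:C *: B) by rewrite opprB addrC subrK.
apply: neumann; apply: (@le_lt_trans _ _ (Num.sqrt (1 - t * d))).
  apply: rnorm_bop_le => [|x]; first by rewrite sqrtr_ge0.
  rewrite -(@ler_pXn2r _ 2)// ?nnegrE ?mulr_ge0 ?sqrtr_ge0 ?rnorm_ge0//.
  rewrite exprMn sqr_sqrtr// !bopE rnorm_distC sqr_rnormB rnormZ cnorm_real ipZl gtr0_norm//.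
  have -> : complex.Re (t%:C * ip (B x) x) = t * complex.Re (ip (B x) x).
    by case: (ip (B x) x) => a b /=; rewrite mul0r subr0.
  have hx := hB x; have Bx := rnorm_apply B x; have x0 := rnorm_ge0 x.
  have Bx0 := rnorm_ge0 (B x).
  have h1 : rnorm (B x) ^+ 2 <= M ^+ 2 * rnorm x ^+ 2.
    rewrite -exprMn ler_pXn2r// ?nnegrE ?mulr_ge0// ?(ltW M0)//.
    by rewrite (le_trans Bx)// ler_wpM2r// /M; lra.
  have h2 : (t * rnorm (B x)) ^+ 2 <= t * d * rnorm x ^+ 2.
    have -> : t * d * rnorm x ^+ 2 = t ^+ 2 * (M ^+ 2 * rnorm x ^+ 2).
      by rewrite -tM; ring.
    by rewrite exprMn ler_wpM2l// exprn_ge0// ltW.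
  by nra.
rewrite -[ltRHS]sqrtr1 ltr_sqrt ?ltr01//.
by have := mulr_gt0 t0 d0; lra.
Qed.

(** Midpoints in [K] have norm at least the infimum, so by the parallelogram law a minimizing
    sequence is Cauchy. It is applied to a translate of a closed subspace in [projection] and to the
    hyperplane f = 1 in [riesz]. *)
Lemma min_norm (K : set H) : K !=set0 ->
  (forall x y, K x -> K y -> K ((2^-1 : R[i]) *: (x + y))) ->
  (forall u l, (forall n, K (u n)) -> tends u l -> K l) ->
  exists2 m, K m & forall x, K x -> rnorm m <= rnorm x.
Proof.
move=> K0 Kmid Kcl.
pose D := [set rnorm x | x in K].
have hD : has_inf D.
  split; first by have [x Kx] := K0; exists (rnorm x), x.
  by exists 0 => _ [x _ <-]; exact: rnorm_ge0.
have Dlb x : K x -> inf D <= rnorm x by move=> Kx; apply: ge_inf; [case: hD|exists x].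
have D0 : 0 <= inf D by apply: lb_le_inf; [case: hD|move=> _ [x _ <-]; exact: rnorm_ge0].
have ex n : exists x, K x /\ rnorm x <= inf D + n.+1%:R^-1.
  have [|_ [x Kx <-] lt] := @inf_adherent _ D n.+1%:R^-1 _ hD; first by rewrite invr_gt0.
  by exists x; split=> //; exact: ltW.
have [u hu] := choice ex.
(* The parallelogram law bounds |x - y|^2 by 4 (inf D + e)^2 - 4 (inf D)^2. *)
have par x y e : 0 <= e -> K x -> K y -> rnorm x <= inf D + e -> rnorm y <= inf D + e ->
    rnorm (x - y) ^+ 2 <= 4 * (2 * inf D * e + e ^+ 2).
  move=> e0 Kx Ky xe ye; have := Dlb _ (Kmid _ _ Kx Ky).
  rewrite rnormZ cnormV cnorm_nat => h.
  have {}h : 2 * inf D <= rnorm (x + y) by lra.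
  have := sqr_rnormD x y; have := sqr_rnormB x y.
  have := rnorm_ge0 x; have := rnorm_ge0 y; have := rnorm_ge0 (x + y).
  by nra.
have sm e : 0 < e -> exists N, forall n, (N <= n)%N -> n.+1%:R^-1 <= e :> R.
  move=> e0; have := @near_infty_natSinv_lt R (PosNum e0).
  by case=> N _ hN; exists N => n /hN /ltW.
have cu : cauchy_seq u.
  move=> e e0.
  pose d := Num.min 1 (e ^+ 2 / (4 * (2 * inf D + 1))).
  have K1 : 0 < 4 * (2 * inf D + 1) by lra.
  have d0 : 0 < d by rewrite lt_min ltr01 divr_gt0// exprn_gt0.
  have d1 : d <= 1 by rewrite ge_min lexx.
  have dK : d * (4 * (2 * inf D + 1)) <= e ^+ 2.
    by rewrite -ler_pdivlMr// ge_min lexx orbT.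
  have [N hN] := sm _ d0; exists N => m n Nm Nn.
  have [Km hm] := hu m; have [Kn hn] := hu n.
  have := par (u m) (u n) d (ltW d0) Km Kn.
  move=> /(_ (le_trans hm _)) /(_ (le_trans hn _)).
  rewrite !lerD2l !hN// => /(_ isT isT) h.
  rewrite -(@ler_pXn2r _ 2)// ?nnegrE ?rnorm_ge0 ?(ltW e0)//.
  by rewrite (le_trans h)// (le_trans _ dK)//; nra.
have [m um] := cauchy_tends cu.
exists m; first by apply: (Kcl u) => // n; case: (hu n).
move=> x Kx; rewrite (le_trans _ (Dlb _ Kx))//.
apply/ler_addgt0Pr => e e0.
have e2 : 0 < e / 2 by rewrite divr_gt0.
have [N hN] := sm _ e2; have [N' hN'] := um _ e2.
pose n := maxn N N'.
rewrite -[m](subrK (u n)) (le_trans (rnormD _ _))// addrC [e]splitr addrA lerD//.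
  by rewrite (le_trans (hu n).2)// lerD2l hN// leq_maxl.
by rewrite rnorm_distC hN'// leq_maxr.
Qed.

Lemma min_norm_orth x y : (forall c, rnorm x <= rnorm (x - c *: y)) -> ip x y = 0.
Proof.
have [->|y0] := eqVneq y 0; first by rewrite ip0r.
move=> h; have ry2 : 0 < rnorm y ^+ 2 by rewrite exprn_gt0// rnorm_gt0.
have := h (ip x y / (rnorm y ^+ 2)%:C).
rewrite -(@ler_pXn2r _ 2)// ?nnegrE ?rnorm_ge0// sqr_rnorm_proj//.
rewrite lerDl oppr_ge0 pmulr_lle0 ?invr_gt0// => c0.
apply/cnorm_eq0/eqP; rewrite -sqrf_eq0; apply/eqP/le_anti.
by rewrite c0 sqr_ge0.
Qed.

Lemma projection (M : set H) : M 0 -> (forall c x y, M x -> M y -> M (c *: x + y)) ->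
  (forall u l, (forall n, M (u n)) -> tends u l -> M l) ->
  forall x, exists2 m, M m & forall y, M y -> ip (x - m) y = 0.
Proof.
move=> M0 Mlin Mcl x.
have MZ c y : M y -> M (c *: y) by move=> My; rewrite -[_ *: _]addr0; exact: Mlin.
have MB y z : M y -> M z -> M (y - z).
  by move=> My Mz; rewrite addrC -scaleN1r; exact: Mlin.
have [|||k Kk kmin] := @min_norm [set k | M (x - k)].
- by exists x; rewrite /= subrr.
- move=> y z /= My Mz.
  rewrite -{1}[x]half_half -scalerBr; apply: MZ; rewrite opprD addrACA.
  by rewrite -[X in M (X + _)]scale1r; exact: Mlin.
- move=> u l /= Mu ul; apply: (Mcl (fun n => x - u n)) => //.
  have := tendsD (tends_cst x) (tendsZ (-1) ul); rewrite scaleN1r.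
  by apply: tends_eq => n; rewrite scaleN1r.
exists (x - k) => // y My; rewrite opprB addrC subrK.
apply: min_norm_orth => c; apply: kmin => /=.
rewrite opprB addrCA addrC -[_ + _ *: _]addrC; exact: Mlin.
Qed.

Lemma riesz (f : H -> R[i]) (M : R) : (forall c x y, f (c *: x + y) = c * f x + f y) ->
  (forall x, cnorm (f x) <= M * rnorm x) -> exists y, forall x, f x = ip x y.
Proof.
move=> lf fM.
have f0 : f 0 = 0 by have := lf (-1) 0 0; rewrite scaler0 addr0 mulN1r addrC subrr.
have fZ c x : f (c *: x) = c * f x by rewrite -[c *: x]addr0 lf f0 addr0.
have fD x y : f (x + y) = f x + f y by rewrite -[x]scale1r lf mul1r scale1r.
have fB x y : f (x - y) = f x - f y by rewrite fD -scaleN1r fZ mulN1r.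
have [[x0 fx0]|all0] := pselect (exists x, f x != 0); last first.
  exists 0 => x; rewrite ip0r; apply/eqP/negPn/negP => fx; apply: all0; by exists x.
have [|||m fm mmin] := @min_norm [set k | f k = 1].
- by exists ((f x0)^-1 *: x0); rewrite /= fZ mulVf.
- by move=> x y /= fx fy; rewrite fZ fD fx fy mulVf// pnatr_eq0.
- move=> u l /= fu ul; apply/eqP; rewrite -subr_eq0; apply/eqP/cnorm_eq0/le_anti.
  rewrite cnorm_ge0 andbT; apply/ler_addgt0Pr => e e0; rewrite add0r.
  have M1 : 0 < `|M| + 1 by have := normr_ge0 M; lra.
  have [N /(_ N (leqnn N))] := ul _ (divr_gt0 e0 M1).
  rewrite ler_pdivlMr// -(fu N) -fB => h.
  rewrite (le_trans (fM _))// rnorm_distC (le_trans _ h)// mulrC.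
  by rewrite ler_wpM2l ?rnorm_ge0// (le_trans (ler_norm M))//; lra.
(* The element [m] of least norm on f = 1 is orthogonal to the kernel of [f], and x - f(x) m lies in
   that kernel. *)
have orth x : ip x m = f x * ip m m.
  have : ip m (x - f x *: m) = 0.
    apply: min_norm_orth => c; apply: mmin => /=.
    by rewrite fB fZ fB fZ fm mulr1 subrr mulr0 subr0.
  move/(congr1 Num.conj); rewrite -ip_conj rmorph0 ipBl ipZl => /eqP.
  by rewrite subr_eq0 => /eqP.
have m0 : ip m m != 0.
  rewrite -ip_norm sqrf_eq0 normr_eq0; apply: contra_eq_neq fm => ->.
  by rewrite f0 eq_sym oner_eq0.
exists ((Num.conj (ip m m))^-1 *: m) => x.
by rewrite ipZr (orth x) fmorphV /= conjCK mulrCA mulVf// mulr1.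
Qed.

Lemma adjoint_ex T : exists S : bop H, forall x y, ip (T x) y = ip x (S y).
Proof.
have ex y : exists z, forall x, ip (T x) y = ip x z.
  apply: (@riesz (fun x => ip (T x) y) (rnorm T * rnorm y)) => [c x x'|x].
    by rewrite linearP ipDl ipZl.
  rewrite (le_trans (cauchy_schwarz _ _))// mulrAC.
  by rewrite ler_wpM2r ?rnorm_ge0// rnorm_apply.
have [f hf] := choice ex.
have fu x y : (forall z, ip z x = ip z y) -> x = y.
  move=> h; apply/eqP; rewrite -subr_eq0; apply/eqP/ip_eq0 => z.
  by rewrite ipBr h subrr.
have lf : linear f.
  by move=> a x y; apply: fu => z; rewrite -hf !ipDr !ipZr -!hf.
have [y|S hS] := @bop_of _ _ f (rnorm T) lf.
  (* Boundedness of the adjoint: |f y|^2 = <T (f y), y>, and one factor |f y| is cancelled below. *)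
  have h : rnorm (f y) * rnorm (f y) <= rnorm T * rnorm y * rnorm (f y).
    rewrite -expr2 sqr_rnorm -hf (le_trans (Re_ip_le _ _))// mulrAC.
    by rewrite ler_wpM2r ?rnorm_ge0// rnorm_apply.
  have [f0|f0] := eqVneq (f y) 0; first by rewrite f0 rnorm0 mulr_ge0 ?rnorm_ge0.
  by rewrite -(ler_pM2r (rnorm_gt0 f0)).
by exists S => x y; rewrite hf hS.
Qed.

Lemma adjointP T x y : ip (T x) y = ip x (adjoint ip T y).
Proof.
have : [set S : bop H | forall x y, ip (T x) y = ip x (S y)] (adjoint ip T).
  by apply: getPex; exact: adjoint_ex.
exact.
Qed.

Lemma adjointPr T x y : ip (adjoint ip T x) y = ip x (T y).
Proof. by rewrite ip_conj -adjointP -ip_conj. Qed.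

Lemma adjoint_eq T S : (forall x y, ip (T x) y = ip x (S y)) -> adjoint ip T = S.
Proof.
move=> h; apply/bopP => y; apply/eqP; rewrite -subr_eq0; apply/eqP/ip_eq0 => x.
by rewrite ipBr -adjointP h subrr.
Qed.

Lemma adjointK T : adjoint ip (adjoint ip T) = T.
Proof. by apply: adjoint_eq => x y; exact: adjointPr. Qed.

Lemma adjointM S T : adjoint ip (S * T) = adjoint ip T * adjoint ip S.
Proof. by apply: adjoint_eq => x y; rewrite !bopE !adjointP. Qed.

Lemma adjointD S T : adjoint ip (S + T) = adjoint ip S + adjoint ip T.
Proof. by apply: adjoint_eq => x y; rewrite !bopE ipDl ipDr !adjointP. Qed.

Lemma adjointZ a T : adjoint ip (a *: T) = Num.conj a *: adjoint ip T.
Proof. by apply: adjoint_eq => x y; rewrite !bopE ipZl ipZr conjCK adjointP. Qed.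

Lemma adjoint1 : adjoint ip 1 = 1.
Proof. exact: adjoint_eq. Qed.

Lemma rnorm_sqr_adjoint T : rnorm T ^+ 2 <= rnorm (adjoint ip T * T).
Proof.
set A := adjoint ip T * T.
have h : rnorm T <= Num.sqrt (rnorm A).
  apply: rnorm_bop_le => [|x]; first by rewrite sqrtr_ge0.
  rewrite -(@ler_pXn2r _ 2)// ?nnegrE ?mulr_ge0 ?sqrtr_ge0 ?rnorm_ge0//.
  rewrite exprMn sqr_sqrtr ?rnorm_ge0// sqr_rnorm -adjointPr.
  rewrite -bop_mulE (le_trans (Re_ip_le _ _))// expr2 mulrA.
  by rewrite ler_wpM2r ?rnorm_ge0// rnorm_apply.
by rewrite -[leRHS](sqr_sqrtr (rnorm_ge0 A)) ler_pXn2r ?nnegrE ?sqrtr_ge0 ?rnorm_ge0.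
Qed.

End hilbert.

(** * Functional calculus of self-adjoint operators *)

Section selfadjoint_operators.
Context {R : realType} {H : completeNormedModType R[i]}.
Variable ip : {dot H for (@Num.conj R[i])}.
Hypothesis ip_norm : forall x : H, `|x| ^+ 2 = ip x x.
Implicit Types (x y : H) (S T A B : bop H) (z c : R[i]) (p q : {poly R[i]}).
Local Notation sa := (selfadjoint ip).
Local Notation "T ^*'" := (adjoint ip T) (at level 2, format "T ^*'").

Lemma selfadjointP A x y : sa A -> ip (A x) y = ip x (A y).
Proof. by move=> Asa; rewrite (adjointP ip_norm) Asa. Qed.

Lemma selfadjoint_of A : (forall x y, ip (A x) y = ip x (A y)) -> sa A.
Proof. exact: adjoint_eq. Qed.

Lemma selfadjoint_sqr A x : sa A -> ip ((A * A) x) x = (rnorm (A x) ^+ 2)%:C.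
Proof. by move=> Asa; rewrite bop_mulE selfadjointP// ipxx. Qed.

Lemma selfadjoint_Im A x : sa A -> complex.Im (ip (A x) x) = 0.
Proof.
move=> Asa; have : ip (A x) x = Num.conj (ip (A x) x).
  by rewrite -ip_conj selfadjointP.
move/(congr1 (@complex.Im R)); rewrite Im_conj; lra.
Qed.

(** Since <A x, x> is real, multiplying A - z by i times the sign of Im z gives a form whose real
    part is exactly |Im z| |x|^2; coercivity then makes A - z invertible. *)
Lemma spectrum_selfadjoint_real A z : sa A -> spectrum A z -> complex.Im z = 0.
Proof.
move=> Asa Az; apply/eqP/negPn/negP => z0; apply: Az.
set b := complex.Im z in z0.
pose c : R[i] := 0 +i* Num.sg b.
have c0 : c != 0 by rewrite eq_complex /= eqxx /= sgr_eq0.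
apply/(op_invertibleZ_iff _ c0).
apply: (@coercive_invertible _ _ ip ip_norm _ `|b|); first by rewrite normr_gt0.
move=> x; rewrite !bopE ipZl ipBl ipZl ipxx//.
have := selfadjoint_Im x Asa; case: (ip (A x) x) => r s /= ->.
rewrite /c /b; case: z @b z0 @c {c0} => u v /= v0.
by rewrite le_eqVlt; apply/orP; left; apply/eqP; rewrite {1}[`|v|]normrEsg; ring.
Qed.

Lemma spectrum_selfadjoint_realE A z : sa A -> spectrum A z -> z = (complex.Re z)%:C.
Proof. by move=> Asa Az; apply: real_complexE; exact: spectrum_selfadjoint_real Asa Az. Qed.

Lemma spectrum_ge (m : R) A z : (forall x, m * rnorm x ^+ 2 <= complex.Re (ip (A x) x)) ->
  spectrum A z -> m <= complex.Re z.
Proof.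
move=> Am Az; rewrite leNgt; apply/negP => zm; apply: Az.
apply: (@coercive_invertible _ _ ip ip_norm _ (m - complex.Re z)); first by rewrite subr_gt0.
move=> x; rewrite !bopE ipBl ipZl ipxx//; have := Am x.
case: (ip (A x) x) => a b /=; case: z zm => u v /=; lra.
Qed.

(* If [A - c] and [A + c] were invertible for [c = |A|], then [A^2 - c^2] would be bounded below, while
   [|(A^2 - c^2) x|^2 <= c^2 (c^2 |x|^2 - |A x|^2)] is not. *)
Lemma spectrum_selfadjoint_norm A : sa A -> 0 < rnorm A ->
  spectrum A (rnorm A)%:C \/ spectrum A (- (rnorm A)%:C).
Proof.
move=> Asa; set c := rnorm A => c0; apply: contrapT => /not_orP[].
move=> /contrapT i1 /contrapT i2.
have [G [_ GB]] := op_invertibleM i1 i2.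
set B := (A - _) * (A - _) in GB.
have BE x : B x = A (A x) - (c ^+ 2)%:C *: x.
  have AE : A (A x + c%:C *: x) = A (A x) + c%:C *: A x by rewrite linearD linearZ.
  rewrite /B !bopE scaleNr opprK AE scalerDr.
  by rewrite opprD addrA addrK scalerA -expr2 -rmorphXn.
have G0 := rnorm_ge0 G.
(* [g] dominates |G|; the last summand ensures g c^2 >= 1, so that c^2 - d below is nonnegative. *)
pose g := rnorm G + 1 + (c ^+ 2)^-1.
have c20 : 0 < c ^+ 2 by rewrite exprn_gt0.
have ic20 : 0 < (c ^+ 2)^-1 by rewrite invr_gt0.
have g0 : 0 < g by rewrite /g; lra.
have gc : 1 <= g * c ^+ 2.
  by rewrite -ler_pdivrMr// div1r /g; lra.
have key x : rnorm x ^+ 2 <= g ^+ 2 * c ^+ 2 * (c ^+ 2 * rnorm x ^+ 2 - rnorm (A x) ^+ 2).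
  have h1 : rnorm x <= g * rnorm (B x).
    rewrite -{1}[x](bop_oneE x) -GB bop_mulE (le_trans (rnorm_apply _ _))//.
    by rewrite ler_wpM2r ?rnorm_ge0// /g; lra.
  have h2 : rnorm (B x) ^+ 2 <= c ^+ 2 * (c ^+ 2 * rnorm x ^+ 2 - rnorm (A x) ^+ 2).
    rewrite BE (sqr_rnormB ip_norm) rnormZ cnorm_real (gtr0_norm c20) ipZr conj_real.
    rewrite selfadjointP// ipxx// -rmorphM /=.
    have : rnorm (A (A x)) ^+ 2 <= (c * rnorm (A x)) ^+ 2.
      by rewrite ler_pXn2r// ?nnegrE ?mulr_ge0 ?rnorm_ge0// rnorm_apply.
    rewrite !exprMn; lra.
  have : rnorm x ^+ 2 <= (g * rnorm (B x)) ^+ 2.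
    by rewrite ler_pXn2r// ?nnegrE ?mulr_ge0 ?rnorm_ge0// ltW.
  rewrite exprMn => h3; rewrite (le_trans h3)// -mulrA ler_wpM2l//.
  by rewrite exprn_ge0// ltW.
(* [key] now reads |A x|^2 <= (c^2 - d) |x|^2, which bounds the norm c of [A] by a number smaller
   than c. *)
pose d := (g ^+ 2 * c ^+ 2)^-1.
have gc0 : 0 < g ^+ 2 * c ^+ 2 by rewrite mulr_gt0// exprn_gt0.
have d0 : 0 < d by rewrite invr_gt0.
have dc : 0 <= c ^+ 2 - d.
  rewrite subr_ge0 /d -div1r ler_pdivrMr//.
  have -> : c ^+ 2 * (g ^+ 2 * c ^+ 2) = (g * c ^+ 2) ^+ 2 by ring.
  exact: exprn_ege1.
have : c <= Num.sqrt (c ^+ 2 - d).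
  apply: rnorm_bop_le => [|x]; first by rewrite sqrtr_ge0.
  rewrite -(@ler_pXn2r _ 2)// ?nnegrE ?mulr_ge0 ?sqrtr_ge0 ?rnorm_ge0//.
  rewrite exprMn sqr_sqrtr// mulrBl lerBrDr -lerBrDl.
  by rewrite /d mulrC ler_pdivrMr// mulrC key.
rewrite -(@ler_pXn2r _ 2)// ?nnegrE ?sqrtr_ge0// ?(ltW c0)// sqr_sqrtr//; lra.
Qed.

Lemma spectrum_selfadjoint_nonempty A : sa A -> (1 : bop H) <> 0 -> exists z, spectrum A z.
Proof.
move=> Asa n10; have := rnorm_ge0 A; rewrite le_eqVlt => /predU1P[A0|A0]; last first.
  by have [?|?] := spectrum_selfadjoint_norm Asa A0; eexists; eassumption.
exists 0; rewrite /spectrum /= scale0r subr0 (@rnorm_eq0 _ _ A)// => -[S [h _]].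
by apply: n10; rewrite -h mul0r.
Qed.

Lemma adjoint_op_poly p T : (op_poly p T)^*' = op_poly (map_poly (@Num.conj R[i]) p) T^*'.
Proof.
elim/poly_ind: p => [|p c IH].
  rewrite rmorph0 -polyC0 !op_polyC !scale0r -(scale0r (0 : bop H)) (adjointZ ip_norm).
  by rewrite rmorph0 !scale0r.
rewrite rmorphD rmorphM /= map_polyX map_polyC /= !op_polyD !op_polyMX !op_polyC.
rewrite (adjointD ip_norm) (adjointM ip_norm) (adjointZ ip_norm) (adjoint1 ip_norm) IH.
by rewrite op_poly_comm.
Qed.

Lemma map_poly_conj_real p (x : R) :
  (map_poly (@Num.conj R[i]) p).[x%:C] = Num.conj p.[x%:C].
Proof. by rewrite -[X in _.[X]]conj_real horner_map. Qed.

Lemma op_poly_bound A p (M : R) : sa A -> 0 <= M ->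
  (forall z, spectrum A z -> cnorm p.[z] <= M) -> rnorm (op_poly p A) <= M.
Proof.
move=> Asa M0 pM.
(* On the spectrum, which is real, q(z) = |p(z)|^2. *)
pose q := map_poly (@Num.conj R[i]) p * p.
have qE : (op_poly p A)^*' * op_poly p A = op_poly q A.
  by rewrite adjoint_op_poly Asa op_polyM.
have qsa : sa (op_poly q A).
  by rewrite /selfadjoint -qE (adjointM ip_norm) (adjointK ip_norm).
have qz z : spectrum A z -> q.[z] = (cnorm p.[z] ^+ 2)%:C.
  move=> Az; rewrite (spectrum_selfadjoint_realE Asa Az).
  by rewrite hornerM map_poly_conj_real conjM_cnorm.
have h := rnorm_sqr_adjoint ip_norm (op_poly p A); rewrite qE in h.
suff {h} h' : rnorm (op_poly q A) <= M ^+ 2.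
  by rewrite -(@ler_pXn2r _ 2)// ?nnegrE ?rnorm_ge0// (le_trans h).
have := rnorm_ge0 (op_poly q A); rewrite le_eqVlt => /predU1P[<-|q0].
  by rewrite exprn_ge0.
have n10 : (1 : bop H) <> 0.
  move=> e; move: q0; rewrite -[op_poly q A]mulr1 e mulr0 rnorm0; lra.
have root z : spectrum (op_poly q A) z -> exists2 w, spectrum A w & q.[w] = z.
  rewrite /spectrum /= -(op_polyC z A) -op_polyB => ni.
  (* [op_poly_root] excludes the zero polynomial; if q is the constant z, any point of the nonempty
     spectrum will do. *)
  have [e|n0] := eqVneq (q - z%:P) 0.
    have [w Aw] := spectrum_selfadjoint_nonempty Asa n10; exists w => //.
    by have /eqP := e; rewrite subr_eq0 => /eqP ->; rewrite hornerC.
  have [w Aw e] := op_poly_root n0 ni; exists w => //.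
  by move: e; rewrite hornerD hornerN hornerC => /eqP; rewrite subr_eq0 => /eqP.
have pos w : spectrum A w -> cnorm p.[w] ^+ 2 <= M ^+ 2.
  by move=> Aw; rewrite ler_pXn2r// ?nnegrE ?cnorm_ge0// pM.
have [/root[w Aw]|/root[w Aw]] := spectrum_selfadjoint_norm qsa q0.
  by rewrite qz// => /complexI <-; exact: pos.
(* The spectral value -|q(A)| is negative and cannot equal |p(w)|^2. *)
rewrite qz// -rmorphN => /complexI e; have := pos _ Aw; have := exprn_ge0 2 (cnorm_ge0 p.[w]).
by rewrite e; lra.
Qed.

Lemma poly_bounded p (K : R) : exists B : R, forall z, cnorm z <= K -> cnorm p.[z] <= B.
Proof.
elim/poly_ind: p => [|p c [B hB]].
  by exists 0 => z _; rewrite horner0 cnorm0.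
exists (`|B| * `|K| + cnorm c) => z zK.
rewrite hornerMXaddC (le_trans (cnormD _ _))// lerD2r cnormM.
by rewrite ler_pM ?cnorm_ge0// (le_trans _ (ler_norm _))// hB.
Qed.

(** The relation S = f(A), as the closure of the graph of the polynomial calculus: a single
    polynomial approximates both [f] on the spectrum and [S] in norm. Algebraic rules follow by
    approximation; for self-adjoint [A], uniqueness comes from [op_poly_bound]. *)
Definition fcalc A (f : R[i] -> R[i]) S := forall e : R, 0 < e -> exists p,
  (forall z, spectrum A z -> cnorm (p.[z] - f z) <= e) /\ rnorm (op_poly p A - S) <= e.

(** The bound [op_poly_bound] passed to the closure. Uniqueness, the norm bound on f(A) and the
    convergence of the exponential series are all instances. *)
Lemma fcalc_dist A f g S T (M : R) : sa A -> 0 <= M -> fcalc A f S -> fcalc A g T ->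
  (forall z, spectrum A z -> cnorm (f z - g z) <= M) -> rnorm (S - T) <= M.
Proof.
move=> Asa M0 fS gT fg; apply/ler_addgt0Pr => e e0.
have e4 : 0 < e / 4 by rewrite divr_gt0.
have [p [pf pS]] := fS _ e4; have [q [qg qT]] := gT _ e4.
have : rnorm (op_poly (p - q) A) <= M + e / 4 + e / 4.
  apply: op_poly_bound => // [|z Az]; first by lra.
  have -> : (p - q).[z] = (p.[z] - f z) + (f z - g z) - (q.[z] - g z).
    rewrite hornerD hornerN; ring.
  have h1 := pf _ Az; have h2 := qg _ Az; have h3 := fg _ Az.
  have := cnormB ((p.[z] - f z) + (f z - g z)) (q.[z] - g z).
  have := cnormD (p.[z] - f z) (f z - g z); lra.
rewrite op_polyB => h.
have -> : S - T = (op_poly p A - op_poly q A) - (op_poly p A - S) + (op_poly q A - T).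
  by rewrite opprB [_ + (S - _)]addrC (addrA (S - _)) subrK addrA subrK.
have := rnormD ((op_poly p A - op_poly q A) - (op_poly p A - S)) (op_poly q A - T).
have := rnormB (op_poly p A - op_poly q A) (op_poly p A - S); lra.
Qed.

Lemma fcalc_unique A f S T : sa A -> fcalc A f S -> fcalc A f T -> S = T.
Proof.
move=> Asa fS fT; apply: rnorm_eq_of_small => e e0.
by apply: (fcalc_dist Asa (ltW e0) fS fT) => z _; rewrite subrr cnorm0 ltW.
Qed.

Lemma fcalc_ext A f g S : (forall z, spectrum A z -> f z = g z) -> fcalc A f S -> fcalc A g S.
Proof.
move=> fg fS e e0; have [p [pf pS]] := fS _ e0; exists p; split=> // z Az.
by rewrite -fg// pf.
Qed.

Lemma fcalc_poly A p : fcalc A (fun z => p.[z]) (op_poly p A).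
Proof.
by move=> e e0; exists p; split=> [z _|]; rewrite subrr ?cnorm0 ?rnorm0 ltW.
Qed.

Lemma fcalc_cst A c : fcalc A (fun=> c) (c *: (1 : bop H)).
Proof.
have := @fcalc_poly A c%:P; rewrite op_polyC; apply: fcalc_ext => z _.
by rewrite hornerC.
Qed.

Lemma fcalc_id A : fcalc A id A.
Proof.
have := @fcalc_poly A 'X; rewrite op_polyX; apply: fcalc_ext => z _.
by rewrite hornerX.
Qed.

Lemma fcalc_norm A f S (M : R) : sa A -> 0 <= M -> fcalc A f S ->
  (forall z, spectrum A z -> cnorm (f z) <= M) -> rnorm S <= M.
Proof.
move=> Asa M0 fS fM; rewrite -[S]subr0; have h0 := @fcalc_cst A 0.
by rewrite scale0r in h0; apply: (fcalc_dist Asa M0 fS h0) => z Az; rewrite subr0 fM.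
Qed.

Lemma fcalcD A f g S T : fcalc A f S -> fcalc A g T -> fcalc A (fun z => f z + g z) (S + T).
Proof.
move=> fS gT e e0; have e2 : 0 < e / 2 by rewrite divr_gt0.
have [p [pf pS]] := fS _ e2; have [q [qg qT]] := gT _ e2.
exists (p + q); split=> [z Az|].
  by rewrite hornerD opprD addrACA (le_trans (cnormD _ _))// [leRHS]splitr lerD ?pf ?qg.
by rewrite op_polyD opprD addrACA (le_trans (rnormD _ _))// [leRHS]splitr lerD.
Qed.

Lemma fcalc_bounded A f S : fcalc A f S ->
  exists2 B : R, 0 <= B & forall z, spectrum A z -> cnorm (f z) <= B.
Proof.
move=> fS; have [p [pf _]] := fS _ ltr01.
have [B hB] := poly_bounded p (rnorm A); exists (`|B| + 1) => [|z Az].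
  by rewrite addr_ge0.
have := pf _ Az; have := hB _ (spectrum_bound Az); have := ler_norm B.
have := cnormB p.[z] (p.[z] - f z); rewrite opprB addrC subrK; lra.
Qed.

Lemma fcalcM A f g S T : fcalc A f S -> fcalc A g T -> fcalc A (fun z => f z * g z) (S * T).
Proof.
move=> fS gT e e0.
have [B B0 hB] := fcalc_bounded fS; have [C C0 hC] := fcalc_bounded gT.
have S0 := rnorm_ge0 S; have T0 := rnorm_ge0 T.
pose K := B + C + rnorm S + rnorm T + 1; have K0 : 0 < K by rewrite /K; lra.
pose d := Num.min 1 (e / K).
have d0 : 0 < d by rewrite lt_min ltr01 divr_gt0.
have d1 : d <= 1 by rewrite ge_min lexx.
have dK : d * K <= e by rewrite -ler_pdivlMr// ge_min lexx orbT.
rewrite /K in dK.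
have [p [pf pS]] := fS _ d0; have [q [qg qT]] := gT _ d0.
exists (p * q); split=> [z Az|].
  have h1 := pf _ Az; have h2 := qg _ Az; have hf := hB _ Az; have hg := hC _ Az.
  have -> : (p * q).[z] - f z * g z =
      (p.[z] - f z) * (q.[z] - g z) + (p.[z] - f z) * g z + f z * (q.[z] - g z).
    by rewrite hornerM; ring.
  have := cnormD ((p.[z] - f z) * (q.[z] - g z) + (p.[z] - f z) * g z) (f z * (q.[z] - g z)).
  have := cnormD ((p.[z] - f z) * (q.[z] - g z)) ((p.[z] - f z) * g z).
  rewrite !cnormM; have := cnorm_ge0 (p.[z] - f z); have := cnorm_ge0 (q.[z] - g z).
  have := cnorm_ge0 (f z); have := cnorm_ge0 (g z); nra.
rewrite op_polyM; set P := op_poly p A in pS *; set Q := op_poly q A in qT *.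
have -> : P * Q - S * T = (P - S) * (Q - T) + (P - S) * T + S * (Q - T).
  by rewrite -mulrDr subrK mulrBl mulrBr addrA subrK.
have := rnormD ((P - S) * (Q - T) + (P - S) * T) (S * (Q - T)).
have := rnormD ((P - S) * (Q - T)) ((P - S) * T).
have := rnorm_mul (P - S) (Q - T); have := rnorm_mul (P - S) T; have := rnorm_mul S (Q - T).
have := rnorm_ge0 (P - S); have := rnorm_ge0 (Q - T); nra.
Qed.

Lemma fcalcZ A c f S : fcalc A f S -> fcalc A (fun z => c * f z) (c *: S).
Proof.
by move=> fS; have := fcalcM (fcalc_cst A c) fS; rewrite bop_scaleAl mul1r.
Qed.

Lemma rnorm_adjoint T : rnorm T^*' <= rnorm T.
Proof.
apply: rnorm_bop_le => [|x]; first exact: rnorm_ge0.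
have [f0|f0] := eqVneq (T^*' x) 0; first by rewrite f0 rnorm0 mulr_ge0 ?rnorm_ge0.
rewrite -(ler_pM2r (rnorm_gt0 f0)) -expr2 (sqr_rnorm ip_norm) -(adjointP ip_norm).
rewrite (le_trans (Re_ip_le ip_norm _ _))// mulrAC.
by rewrite ler_wpM2r ?rnorm_ge0// rnorm_apply.
Qed.

Lemma adjointB S T : (S - T)^*' = S^*' - T^*'.
Proof. by rewrite -scaleN1r (adjointD ip_norm) (adjointZ ip_norm) rmorphN1 scaleN1r. Qed.

(** Conjugating the coefficients of a polynomial conjugates its values only at real points; the
    spectrum being real is what makes this work. *)
Lemma fcalc_adjoint A f S : sa A -> fcalc A f S -> fcalc A (fun z => Num.conj (f z)) S^*'.
Proof.
move=> Asa fS e e0; have [p [pf pS]] := fS _ e0.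
exists (map_poly (@Num.conj R[i]) p); split=> [z Az|].
  have := pf _ Az; rewrite (spectrum_selfadjoint_realE Asa Az) map_poly_conj_real.
  by rewrite -rmorphB -[cnorm (Num.conj _)]/(cnorm (_^*)) cnorm_conj.
by rewrite -[in op_poly _ _]Asa -adjoint_op_poly -adjointB (le_trans (rnorm_adjoint _)).
Qed.

Lemma fcalc_selfadjoint A f S : sa A -> fcalc A f S ->
  (forall z, spectrum A z -> complex.Im (f z) = 0) -> sa S.
Proof.
move=> Asa fS fre; apply: (fcalc_unique Asa _ fS).
apply: fcalc_ext (fcalc_adjoint Asa fS) => z Az.
by rewrite (real_complexE (fre _ Az)) conj_real.
Qed.

Lemma fcalc_lim A f S : (forall e : R, 0 < e -> exists g T, [/\ fcalc A g T,
    forall z, spectrum A z -> cnorm (g z - f z) <= e & rnorm (T - S) <= e]) -> fcalc A f S.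
Proof.
move=> h e e0; have e2 : 0 < e / 2 by rewrite divr_gt0.
have [g [T [gT gf TS]]] := h _ e2; have [p [pg pT]] := gT _ e2.
exists p; split=> [z Az|].
  have -> : p.[z] - f z = (p.[z] - g z) + (g z - f z) by rewrite addrA subrK.
  by rewrite (le_trans (cnormD _ _))// [leRHS]splitr lerD ?pg ?gf.
by rewrite (le_trans (rnorm_triangle T _ _))// [leRHS]splitr lerD.
Qed.

Definition poly_approx A (f : R[i] -> R[i]) := forall e : R, 0 < e ->
  exists p : {poly R[i]}, forall z, spectrum A z -> cnorm (p.[z] - f z) <= e.

Lemma fcalc_tends A f : sa A -> poly_approx A f -> exists (p : nat -> {poly R[i]}) S,
  [/\ forall n z, spectrum A z -> cnorm ((p n).[z] - f z) <= n.+1%:R^-1,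
   tends (fun n => op_poly (p n) A) S & fcalc A f S].
Proof.
move=> Asa fap.
have [p hp] := choice (fun n : nat => fap n.+1%:R^-1 ltac:(by rewrite invr_gt0)).
have sm e : 0 < e -> exists N, forall n, (N <= n)%N -> n.+1%:R^-1 <= e :> R.
  move=> e0; have := @near_infty_natSinv_lt R (PosNum e0).
  by case=> N _ hN; exists N => n /hN /ltW.
have cp : cauchy_seq (fun n => op_poly (p n) A).
  move=> e e0; have e2 : 0 < e / 2 by rewrite divr_gt0.
  have [N hN] := sm _ e2; exists N => m n Nm Nn.
  rewrite -op_polyB; apply: (op_poly_bound Asa (ltW e0)) => z Az.
  have -> : (p m - p n).[z] = ((p m).[z] - f z) - ((p n).[z] - f z).
    by rewrite hornerD hornerN opprB addrA subrK.
  rewrite (le_trans (cnormB _ _))// [leRHS]splitr lerD//.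
    by rewrite (le_trans (hp _ _ Az))// hN.
  by rewrite (le_trans (hp _ _ Az))// hN.
have [S pS] := bop_cauchy_tends cp.
exists p, S; split=> // e e0; have [N hN] := sm _ e0; have [N' hN'] := pS _ e0.
exists (p (maxn N N')); split=> [z Az|]; last by rewrite hN'// leq_maxr.
by rewrite (le_trans (hp _ _ Az))// hN// leq_maxl.
Qed.

Lemma fcalc_ex A f : sa A -> poly_approx A f -> exists S, fcalc A f S.
Proof. by move=> Asa /(fcalc_tends Asa)[p [S [_ _ ?]]]; exists S. Qed.

(** The set under [get] is inhabited by [fcalc_tends], and each of its members satisfies [fcalc], so
    the choice made by [get] is immaterial. The rest translates between uniform convergence as a
    filter and explicit bounds. *)
Lemma op_fun_calculusP A (f : R[i] -> R[i]^o) : sa A -> poly_approx A f ->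
  fcalc A f (op_fun_calculus f A).
Proof.
move=> Asa fap; set P := [set S : bop H | exists p : nat -> {poly R[i]},
    {uniform spectrum A, (fun n z => (p n).[z] : R[i]^o) @ \oo --> f} /\
    (fun n => op_poly (p n) A) @ \oo --> S].
have [p [S [pf pS _]]] := fcalc_tends Asa fap.
have : P (op_fun_calculus f A).
  apply: getPex; exists S, p; split; last exact/tendsP.
  move=> Q /uniform_nbhs[E [entE EQ]].
  have [e /= e0 eE] : exists2 e : R[i], 0 < e & forall z w : R[i]^o, `|z - w| < e -> E (z, w).
    move: entE; rewrite -entourage_ballE => -[e /= e0 he]; exists e => // z w zw.
    by apply: he => /=; rewrite -ball_normE.
  have e0' : 0 < complex.Re e by rewrite -ltcR RRe_real ?gtr0_real.
  have := @near_infty_natSinv_lt R (PosNum e0').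
  case=> N _ hN; exists N => // n /= /hN ne; apply: EQ => z Az /=; apply: eE.
  rewrite distrC -[ltLHS]cnormE -(RRe_real (gtr0_real e0)) ltcR.
  exact: le_lt_trans (pf _ _ Az) ne.
move=> [q [qf /tendsP qS]] e e0; have [N hN] := qS _ e0.
have : nbhs (f : {uniform` spectrum A -> R[i]^o})
    [set h : {uniform` spectrum A -> R[i]^o} | forall z, spectrum A z -> cnorm (h z - f z) <= e].
  apply/uniform_nbhs; exists [set zw : R[i]^o * R[i]^o | ball zw.1 e%:C zw.2]; split.
    by rewrite -entourage_ballE; exists e%:C => //=; rewrite ltcR.
  move=> h /= hh z Az; rewrite -lecR cnormE distrC ltW//.
  by have := hh _ Az; rewrite -ball_normE.
move=> /qf[N' _ hN'].
exists (q (maxn N N')); split; last by rewrite hN// leq_maxl.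
by apply: (hN' (maxn N N')); rewrite /= leq_maxr.
Qed.

Lemma fcalc_comp_poly A f S q : fcalc A f S -> fcalc A (fun z => q.[f z]) (op_poly q S).
Proof.
move=> fS; elim/poly_ind: q => [|q c IH].
  rewrite -polyC0 op_polyC; apply: fcalc_ext (fcalc_cst A 0) => z _.
  by rewrite hornerC.
rewrite op_polyD op_polyMX op_polyC.
apply: fcalc_ext (fcalcD (fcalcM IH fS) (fcalc_cst A c)) => z _.
by rewrite hornerMXaddC.
Qed.

End selfadjoint_operators.

(** * Polynomial approximation *)

Section bernstein.
Context {R : realType}.
Implicit Types (f g : nat -> R) (x : R).

(* [bernstein n f] is [\sum_(k <= n) 'C(n, k) f k X^k (1 - X)^(n - k)], the expectation of [f] under the
   binomial law, in the recursive form obtained by conditioning on the first trial. *)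
Fixpoint bernstein n f : {poly R} :=
  if n is n'.+1 then 'X * bernstein n' (f \o S) + (1 - 'X) * bernstein n' f
  else (f 0%N)%:P.

Lemma bernsteinS n f x : (bernstein n.+1 f).[x] =
  x * (bernstein n (f \o S)).[x] + (1 - x) * (bernstein n f).[x].
Proof. by rewrite /= !hornerE. Qed.

Lemma bernstein_le n f g x : 0 <= x <= 1 -> (forall k, (k <= n)%N -> f k <= g k) ->
  (bernstein n f).[x] <= (bernstein n g).[x].
Proof.
move=> /andP[x0 x1]; elim: n f g => [|n IH] f g fg; first by rewrite /= !hornerC fg.
rewrite !bernsteinS lerD// ler_wpM2l ?subr_ge0// IH// => k kn; first exact: fg.
by rewrite fg// (leq_trans kn).
Qed.

Lemma bernstein_lin n f g (a b : R) x :
  (bernstein n (fun k => a * f k + b * g k)).[x] =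
  a * (bernstein n f).[x] + b * (bernstein n g).[x].
Proof.
elim: n f g => [|n IH] f g; first by rewrite /= !hornerC.
rewrite !bernsteinS (IH f g) (_ : (_ \o S) = (fun k => a * (f \o S) k + b * (g \o S) k))//.
rewrite IH; ring.
Qed.

Lemma bernstein_cst n (c : R) x : (bernstein n (fun=> c)).[x] = c.
Proof.
elim: n => [|n IH]; first by rewrite /= hornerC.
rewrite bernsteinS !IH; ring.
Qed.

(** Variance plus squared bias of a binomial variable. The centre [a] is arbitrary because a success
    in the first trial moves it to a - 1 in the induction. *)
Lemma bernstein_variance n (a : R) x :
  (bernstein n (fun k => (k%:R - a) ^+ 2)).[x] = n%:R * x * (1 - x) + (n%:R * x - a) ^+ 2.
Proof.
elim: n a => [|n IH] a; first by rewrite /= hornerC; ring.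
rewrite bernsteinS IH (_ : (_ \o S) = (fun k => (k%:R - (a - 1)) ^+ 2)).
  by rewrite IH -natr1; ring.
by apply/funext => k /=; rewrite -natr1; ring.
Qed.

(** The hypothesis is uniform continuity in a form made for Chebyshev's argument: the expectation of
    (x - y)^2 is a variance, so no splitting into near and far points is made. *)
Lemma bernstein_approx (h : R -> R) (M : R) : 0 < M ->
  (forall e : R, 0 < e -> exists K : R, forall x y : R, 0 <= x <= M -> 0 <= y <= M ->
    `|h x - h y| <= e + K * (x - y) ^+ 2) ->
  forall e : R, 0 < e -> exists p : {poly R}, forall x : R, 0 <= x <= M -> `|p.[x] - h x| <= e.
Proof.
move=> M0 hm e e0; have [K hK] := hm _ (divr_gt0 e0 (ltr0n R 2)).
pose L := `|K| * M ^+ 2 + 1.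
have L0 : 0 < L by rewrite ltr_wpDl// mulr_ge0// exprn_ge0// ltW.
have [n] : exists n : nat, L / (e / 2) < n.+1%:R.
  exists (Num.trunc (L / (e / 2))); rewrite truncnS_gt//.
rewrite ltr_pdivrMr ?divr_gt0// => hn.
pose N : R := n.+1%:R; have N0 : 0 < N by rewrite ltr0n.
exists (bernstein n.+1 (fun k => h (M * (k%:R / N))) \Po (M^-1 *: 'X)) => x /andP[x0 xM].
rewrite horner_comp hornerZ hornerX; set t := M^-1 * x.
have t01 : 0 <= t <= 1.
  by rewrite /t mulr_ge0 ?invr_ge0 ?(ltW M0)//= mulrC ler_pdivrMr// mul1r.
have xE : x = M * t by rewrite /t mulrA divff ?mul1r// gt_eqF.
(* The modulus at M k / N - x = (M / N) (k - N t). Its binomial mean is e / 2 + (|K| M^2 / N) t (1 -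
   t), and [n] was chosen to make the second term at most e / 2. *)
pose d (k : nat) := e / 2 * 1 + `|K| * M ^+ 2 / N ^+ 2 * (k%:R - N * t) ^+ 2.
have dB : (bernstein n.+1 d).[t] <= e.
  rewrite bernstein_lin bernstein_cst bernstein_variance -/N subrr expr0n addr0.
  have -> : `|K| * M ^+ 2 / N ^+ 2 * (N * t * (1 - t)) = (`|K| * M ^+ 2 / N) * (t * (1 - t)).
    by field; rewrite gt_eqF.
  have /andP[t0 t1] := t01.
  have tt : t * (1 - t) <= 1 by nra.
  have h1 : `|K| * M ^+ 2 / N <= e / 2.
    by rewrite ler_pdivrMr//; rewrite -/N /L in hn; lra.
  have h2 : 0 <= `|K| * M ^+ 2 / N.
    by rewrite divr_ge0// ?(ltW N0)// mulr_ge0// exprn_ge0// ltW.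
  by rewrite mulr1 [leRHS]splitr lerD2l (le_trans (ler_piMr h2 tt)).
have hd k : (k <= n.+1)%N -> `|h (M * (k%:R / N)) - h x| <= d k.
  move=> kn; have kN : k%:R / N <= 1 by rewrite ler_pdivrMr// mul1r ler_nat.
  have k0 : 0 <= k%:R / N by rewrite divr_ge0// ltW.
  have := hK (M * (k%:R / N)) x; rewrite x0 xM mulr_ge0//=; last exact: ltW.
  rewrite ger_pMr// kN => /(_ isT isT) h1; rewrite (le_trans h1)// /d mulr1 lerD2l.
  have -> : M * (k%:R / N) - x = M / N * (k%:R - N * t).
    by rewrite xE; field; rewrite gt_eqF.
  rewrite exprMn mulrA ler_wpM2r ?sqr_ge0// -mulrA -exprVn -exprMn.
  by rewrite ler_wpM2r ?sqr_ge0// ler_norm.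
have up : (bernstein n.+1 (fun k => h (M * (k%:R / N)))).[t] <=
    (bernstein n.+1 (fun k => 1 * d k + 1 * h x)).[t].
  by apply: bernstein_le => // k /hd; rewrite ler_norml; lra.
have lo : (bernstein n.+1 (fun k => (-1) * d k + 1 * h x)).[t] <=
    (bernstein n.+1 (fun k => h (M * (k%:R / N)))).[t].
  by apply: bernstein_le => // k /hd; rewrite ler_norml; lra.
rewrite bernstein_lin bernstein_cst in up; rewrite bernstein_lin bernstein_cst in lo.
by rewrite ler_norml; lra.
Qed.

End bernstein.

(** * Powers and exponentials *)

Section moduli.
Context {R : realType}.
Implicit Types (a x y h e M : R).

Lemma powR_ge_id a x : a <= 1 -> 0 <= x <= 1 -> x <= x `^ a.
Proof.
move=> a1 /andP[x0 x1]; have [->|n0] := eqVneq x 0; first exact: powR_ge0.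
by apply: ger1_powR => //; rewrite lt_def n0 x0.
Qed.

(** With s = x + h, the fractions x / s and h / s lie in [0, 1], where raising to the power a <= 1
    does not decrease; they sum to 1. *)
Lemma powR_subadd a x h : a <= 1 -> 0 <= x -> 0 <= h -> (x + h) `^ a <= x `^ a + h `^ a.
Proof.
move=> a1 x0 h0; have [s0|n0] := eqVneq (x + h) 0.
  have [-> ->] : x = 0 /\ h = 0 by split; lra.
  by rewrite addr0 lerDl powR_ge0.
set s := x + h in n0 *.
have s0 : 0 < s by rewrite lt_def n0 addr_ge0.
have part u : 0 <= u -> u <= s -> u / s * s `^ a <= u `^ a.
  move=> u0 us; rewrite -{2}(divfK n0 u) powRM ?divr_ge0 ?(ltW s0)//.
  rewrite ler_wpM2r ?powR_ge0// powR_ge_id// divr_ge0 ?(ltW s0)//=.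
  by rewrite ler_pdivrMr// mul1r.
have e : s `^ a = x / s * s `^ a + h / s * s `^ a.
  by rewrite -mulrDl -mulrDl divff// mul1r.
by rewrite e lerD// part// /s ?lerDl ?lerDr.
Qed.

Lemma powR_dist a x y : 0 <= a <= 1 -> 0 <= x -> 0 <= y ->
  `|x `^ a - y `^ a| <= `|x - y| `^ a.
Proof.
move=> /andP[a0 a1]; wlog yx : x y / y <= x => [wl x0 y0|x0 y0].
  have [/wl h|/ltW/wl h] := leP y x; first exact: h.
  by rewrite distrC [in leRHS]distrC; exact: h.
have m : y `^ a <= x `^ a by apply: ge0_ler_powR.
rewrite !ger0_norm ?subr_ge0// lerBlDl -{1}[x](subrK y) addrC.
by rewrite powR_subadd// subr_ge0.
Qed.

Lemma powR_modulus a e : 0 < a <= 1 -> 0 < e ->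
  exists K : R, forall x y, 0 <= x -> 0 <= y -> `|x `^ a - y `^ a| <= e + K * (x - y) ^+ 2.
Proof.
move=> /andP[a0 a1] e0.
(* If h = |x - y| is at most d, then h^a <= e. Otherwise h^a <= 1 + h, and h / d > 1 gives 1 <= h^2
   / d^2 and h <= h^2 / d; the constant K below is the sum of these coefficients. *)
pose d := e `^ a^-1; have d0 : 0 < d by rewrite powR_gt0.
have id0 : 0 < d^-1 by rewrite invr_gt0.
exists (d^-1 ^+ 2 + d^-1) => x y x0 y0.
rewrite (le_trans (powR_dist _ x0 y0))// ?(ltW a0)//.
rewrite -(real_normK (num_real (x - y))); set h := `|x - y|; have h0 : 0 <= h by exact: normr_ge0.
have [hd|dh] := leP h d.
  have : h `^ a <= e.
    rewrite -[leRHS]powRr1 ?(ltW e0)// -(mulVf (lt0r_neq0 a0)) powRrM.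
    by apply: ge0_ler_powR => //; rewrite ?nnegrE ltW.
  have : 0 <= (d^-1 ^+ 2 + d^-1) * h ^+ 2.
    by rewrite mulr_ge0 ?sqr_ge0// addr_ge0 ?sqr_ge0// ltW.
  lra.
have h1 : h `^ a <= 1 + h.
  have [h1|/ltW h1] := leP h 1.
    have : h `^ a <= 1 `^ a by apply: ge0_ler_powR; rewrite ?nnegrE// ltW.
    by rewrite powR1; lra.
  by rewrite (le_trans (ler1_powR h1 a1))// lerDr.
have u1 : 1 <= d^-1 * h by rewrite mulrC ler_pdivlMr// mul1r ltW.
have : (d^-1 ^+ 2 + d^-1) * h ^+ 2 = (d^-1 * h) ^+ 2 + d^-1 * h * h by ring.
move=> ->; have : 1 <= (d^-1 * h) ^+ 2 by exact: exprn_ege1.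
have : h <= d^-1 * h * h by rewrite ler_peMl.
lra.
Qed.

(** Truncated at 1 the logarithm is 1-Lipschitz on the whole line, and h <= e + h^2 / e for h >= 0.
    The truncation is harmless in [op_exp_sqrt], where the spectrum lies in [1, oo[. *)
Lemma ln_max_modulus e : 0 < e ->
  exists K : R, forall x y, `|ln (Num.max 1 x) - ln (Num.max 1 y)| <= e + K * (x - y) ^+ 2.
Proof.
move=> e0; exists e^-1 => x y.
have lip (u v : R) : 1 <= v -> v <= u -> ln u - ln v <= u - v.
  move=> v1 vu; have v0 : 0 < v by lra.
  have u0 : 0 < u by lra.
  rewrite -ln_div ?posrE//.
  have -> : u / v = 1 + (u - v) / v by field; rewrite gt_eqF.
  have uv : 0 <= (u - v) / v by rewrite divr_ge0 ?subr_ge0// ltW.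
  rewrite (le_trans (le_ln1Dx _))//; first lra.
  by rewrite ler_pdivrMr// ler_peMr// subr_ge0.
have lip2 : `|ln (Num.max 1 x) - ln (Num.max 1 y)| <= `|x - y|.
  wlog yx : x y / y <= x => [wl|].
    have [/wl h|/ltW/wl h] := leP y x; first exact: h.
    by rewrite distrC [in leRHS]distrC; exact: h.
  have mm : Num.max 1 y <= Num.max 1 x by rewrite ge_max !le_max lexx yx orbT.
  have m1 : 1 <= Num.max 1 y by rewrite le_max lexx.
  rewrite ger0_norm; last first.
    by rewrite subr_ge0 ler_ln ?posrE//; [exact: lt_le_trans m1|apply: lt_le_trans (le_trans m1 mm)].
  rewrite (le_trans (lip _ _ m1 mm))// ger0_norm ?subr_ge0//.
  by have [h1|h1] := leP 1 x; have [h2|h2] := leP 1 y; lra.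
rewrite (le_trans lip2)// -(real_normK (num_real (x - y))).
set h := `|x - y|; have h0 : 0 <= h by exact: normr_ge0.
have -> : e^-1 * h ^+ 2 = (h / e) * h by rewrite mulrC expr2 mulrAC.
have : h = (h / e) * e by rewrite divfK// gt_eqF.
set w := h / e => ->; have := sqr_ge0 (w - 1); nra.
Qed.

(** Term by term, the tail at [x] is dominated by the tail of the positive series at [M], whence
    uniformity. *)
Lemma exp_tail M e : 0 < e -> exists N, forall n, (N <= n)%N -> forall x, `|x| <= M ->
  `|series (exp_coeff x) n - expR x| <= e.
Proof.
move=> e0; have [M0|M0] := leP 0 M; last first.
  by exists 0%N => n _ x xM; have := normr_ge0 x; lra.
have cM := is_cvg_series_exp_coeff M.
have := cM => /cvgrPdist_le /(_ _ e0)[N _ hN].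
exists N => n Nn x xM.
have tail m : (n <= m)%N -> `|series (exp_coeff x) m - series (exp_coeff x) n| <= e.
  move=> nm; rewrite sub_series_geq//.
  rewrite (le_trans (ler_norm_sum _ _ _))//.
  apply: (@le_trans _ _ (series (exp_coeff M) m - series (exp_coeff M) n)).
    rewrite sub_series_geq//; apply: ler_sum => i _.
    rewrite /exp_coeff /= normrM normrX [`|_^-1|]ger0_norm ?invr_ge0//.
    by rewrite ler_wpM2r ?invr_ge0// lerXn2r ?nnegrE.
  have := hN n Nn; have : series (exp_coeff M) m <= limn (series (exp_coeff M)).
    apply: nondecreasing_cvgn_le => //.
    apply: nondecreasing_series => k _ _; rewrite /exp_coeff /=.
    by rewrite divr_ge0// exprn_ge0.
  by rewrite ler_norml; lra.
apply/ler_addgt0Pr => d d0.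
have := is_cvg_series_exp_coeff x => /cvgrPdist_le /(_ _ d0)[N' _ hN'].
pose m := maxn n N'.
have h1 : `|series (exp_coeff x) m - series (exp_coeff x) n| <= e by exact: tail (leq_maxl _ _).
have h2 : `|expR x - series (exp_coeff x) m| <= d by exact: hN' (leq_maxr _ _).
rewrite distrC -(subrK (series (exp_coeff x) m) (expR x)) -addrA.
by rewrite (le_trans (ler_normD _ _))// [e + d]addrC lerD.
Qed.

End moduli.

Section powers.
Context {R : realType} {H : completeNormedModType R[i]}.
Variable ip : {dot H for (@Num.conj R[i])}.
Hypothesis ip_norm : forall x : H, `|x| ^+ 2 = ip x x.
Implicit Types (x y : H) (S T A B P : bop H) (z c : R[i]) (a b : R).
Local Notation sa := (selfadjoint ip).
Local Notation "T ^*'" := (adjoint ip T) (at level 2, format "T ^*'").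

Definition op_pos A := sa A /\ forall x, 0 <= complex.Re (ip (A x) x).

Lemma op_pos_spectrum A z : op_pos A -> spectrum A z ->
  z = (complex.Re z)%:C /\ 0 <= complex.Re z <= rnorm A.
Proof.
move=> [Asa A0] Az; split; first exact: (spectrum_selfadjoint_realE ip_norm Asa Az).
rewrite (le_trans (Re_cnorm z) (spectrum_bound Az)) andbT.
by apply: (spectrum_ge ip_norm _ Az) => x; rewrite mul0r.
Qed.

Lemma op_pos_sqr A : sa A -> op_pos (A * A).
Proof.
move=> Asa; split; first by rewrite /selfadjoint (adjointM ip_norm) Asa.
by move=> x; rewrite (selfadjoint_sqr ip_norm _ Asa) /= exprn_ge0// rnorm_ge0.
Qed.

Lemma op_pos_adjointM T : op_pos (T^*' * T).
Proof.
split; first by rewrite /selfadjoint (adjointM ip_norm) (adjointK ip_norm).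
move=> x; rewrite bop_mulE (adjointPr ip_norm) -(sqr_rnorm ip_norm).
by rewrite exprn_ge0// rnorm_ge0.
Qed.

Lemma poly_approx_real A (h : R -> R) : op_pos A ->
  (forall e : R, 0 < e -> exists K : R, forall x y : R,
    0 <= x <= rnorm A + 1 -> 0 <= y <= rnorm A + 1 -> `|h x - h y| <= e + K * (x - y) ^+ 2) ->
  poly_approx A (fun z => (h (complex.Re z))%:C).
Proof.
move=> Apos hm e e0; have A0 := rnorm_ge0 A.
(* The extra 1 keeps the interval nondegenerate when A = 0. *)
have M0 : 0 < rnorm A + 1 by lra.
have [p hp] := bernstein_approx M0 hm e0.
exists (map_poly (real_complex R) p) => z Az.
have [-> /= zA] := op_pos_spectrum Apos Az.
rewrite horner_map -rmorphB cnorm_real hp//; lra.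
Qed.

Lemma op_powerP A a : op_pos A -> 0 <= a <= 1 ->
  fcalc A (fun z => (complex.Re z `^ a)%:C) (op_power A a).
Proof.
move=> Apos /andP[a0 a1]; apply: (op_fun_calculusP ip_norm); first by case: Apos.
have [->|n0] := eqVneq a 0.
  move=> e e0; exists 1 => z _; rewrite powRr0 hornerC subrr cnorm0 ltW//.
apply: (@poly_approx_real _ (fun t => t `^ a)) => // e e0; have [|K hK] := @powR_modulus _ a e _ e0.
  by rewrite lt_def n0 a0 a1.
by exists K => x y /andP[x0 _] /andP[y0 _]; exact: hK.
Qed.

Lemma op_power_sa A a : op_pos A -> 0 <= a <= 1 -> sa (op_power A a).
Proof.
move=> Apos a01; have [Asa _] := Apos.
exact: (fcalc_selfadjoint ip_norm Asa (op_powerP Apos a01)).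
Qed.

Lemma op_powerD A a b : op_pos A -> 0 <= a -> 0 <= b -> a + b <= 1 ->
  op_power A a * op_power A b = op_power A (a + b).
Proof.
move=> Apos a0 b0 ab1; have [Asa _] := Apos.
have fa := @op_powerP _ a Apos ltac:(apply/andP; lra).
have fb := @op_powerP _ b Apos ltac:(apply/andP; lra).
have fab := @op_powerP _ (a + b) Apos ltac:(apply/andP; lra).
apply: (fcalc_unique ip_norm Asa _ fab).
apply: fcalc_ext (fcalcM fa fb) => z Az.
rewrite -rmorphM; congr (_%:C).
(* At the spectral value 0 the law of exponents is delicate only for a + b = 0, which for
   nonnegative exponents means a = b = 0. *)
have [/andP[/eqP a0' /eqP b0']|nab] := boolP ((a == 0) && (b == 0)).
  by rewrite a0' b0' addr0 powRr0 mulr1.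
rewrite powRD//; apply/implyP => ab0; exfalso; move/negP: nab; apply.
by move/eqP: ab0 => ab0; apply/andP; split; apply/eqP; lra.
Qed.

Lemma op_power1 A : op_pos A -> op_power A 1 = A.
Proof.
move=> Apos; have [Asa _] := Apos.
have f1 := @op_powerP _ 1 Apos ltac:(apply/andP; lra).
apply: (fcalc_unique ip_norm Asa f1); apply: fcalc_ext (fcalc_id A) => z Az.
have [zE /andP[z0 _]] := op_pos_spectrum Apos Az.
by rewrite powRr1// -zE.
Qed.

Lemma op_power_pos A a : op_pos A -> 0 <= a <= 1 -> op_pos (op_power A a).
Proof.
move=> Apos /andP[a0 a1].
have -> : op_power A a = op_power A (a / 2) * op_power A (a / 2).
  by rewrite op_powerD -?splitr// divr_ge0.
by apply: op_pos_sqr; apply: op_power_sa => //; apply/andP; lra.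
Qed.

Lemma rnorm_op_power A a : op_pos A -> 0 <= a <= 1 -> rnorm (op_power A a) <= rnorm A `^ a.
Proof.
move=> Apos a01; have [Asa _] := Apos; have /andP[a0 _] := a01.
apply: (fcalc_norm ip_norm Asa (powR_ge0 _ _) (op_powerP Apos a01)) => z Az.
have [zE /andP[z0 zA]] := op_pos_spectrum Apos Az.
by rewrite cnorm_real ger0_norm ?powR_ge0// ge0_ler_powR// nnegrE rnorm_ge0.
Qed.

(** [op_exp] is the norm limit of a power series. Its partial sums at B = f(A) are the functions
    E_n(f(z)) of [A], and since [f] is bounded on the spectrum they converge uniformly to e^f there,
    so the limit is identified by [fcalc_lim]. *)
Lemma exp_fcalc A (f : R[i] -> R[i]) B : sa A -> fcalc A f B ->
  (forall z, spectrum A z -> f z = (complex.Re (f z))%:C) ->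
  fcalc A (fun z => (expR (complex.Re (f z)))%:C) (op_exp B).
Proof.
move=> Asa fB fre; have [M M0 fM] := fcalc_bounded fB.
pose E n : {poly R[i]} := \sum_(0 <= k < n) ((k`!%:R^-1 : R[i]) *: 'X^k).
have EB n : op_poly (E n) B = series (fun k => (k`!%:R^-1 : R[i]) *: B ^+ k) n.
  rewrite /E /series /=; elim: n => [|n IH].
    by rewrite !big_nil -polyC0 op_polyC scale0r.
  rewrite !big_nat_recr//= op_polyD IH op_polyZ; congr (_ + _ *: _).
  elim: n {IH} => [|n IH]; first by rewrite !expr0 -polyC1 op_polyC scale1r.
  by rewrite !exprSr op_polyMX IH.
have Ef n z : spectrum A z -> (E n).[f z] = (series (exp_coeff (complex.Re (f z))) n)%:C.
  move=> Az; rewrite {1}(fre _ Az) /E /series /= horner_sum rmorph_sum.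
  apply: eq_bigr => k _; rewrite hornerZ hornerXn /exp_coeff /= rmorphM /= rmorphXn /=.
  by rewrite fmorphV /= rmorph_nat mulrC.
have Etail e : 0 < e -> exists N, forall n, (N <= n)%N -> forall z, spectrum A z ->
    cnorm ((E n).[f z] - (expR (complex.Re (f z)))%:C) <= e.
  move=> e0; have [N hN] := exp_tail M e0; exists N => n Nn z Az.
  rewrite Ef// -rmorphB cnorm_real hN//.
  by have := fM _ Az; rewrite {1}(fre _ Az) cnorm_real.
have cu : cauchy_seq (fun n => op_poly (E n) B).
  move=> e e0; have e2 : 0 < e / 2 by rewrite divr_gt0.
  have [N hN] := Etail _ e2; exists N => m n Nm Nn.
  apply: (fcalc_dist ip_norm Asa (ltW e0) (fcalc_comp_poly (E m) fB) (fcalc_comp_poly (E n) fB)).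
  move=> z Az; set w := (expR (complex.Re (f z)))%:C.
  have -> : (E m).[f z] - (E n).[f z] = ((E m).[f z] - w) - ((E n).[f z] - w).
    by rewrite opprB addrA subrK.
  by rewrite (le_trans (cnormB _ _))// [leRHS]splitr lerD// hN.
have [L uL] := bop_cauchy_tends cu.
have -> : op_exp B = L.
  apply: (cvg_lim (@norm_hausdorff _ _)); apply/tendsP; apply: tends_eq uL => n.
  exact: EB.
apply: fcalc_lim => e e0; have [N hN] := Etail _ e0; have [N' hN'] := uL _ e0.
exists (fun z => (E (maxn N N')).[f z]), (op_poly (E (maxn N N')) B); split.
- exact: fcalc_comp_poly.
- by move=> z Az; rewrite hN// leq_maxl.
- by rewrite hN'// leq_maxr.
Qed.

Lemma op_expN_inverse A : sa A -> op_inverse (op_exp A) (op_exp (- A)).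
Proof.
move=> Asa.
have re z : spectrum A z -> z = (complex.Re z)%:C.
  exact: (spectrum_selfadjoint_realE ip_norm Asa).
have fA := exp_fcalc Asa (fcalc_id A) re.
have fN : fcalc A (fun z => - z) (- A).
  by rewrite -scaleN1r; apply: fcalc_ext (fcalcZ (-1) (fcalc_id A)) => z _; rewrite mulN1r.
have fNA := exp_fcalc Asa fN _.
have {}fNA : fcalc A (fun z => (expR (complex.Re (- z)))%:C) (op_exp (- A)).
  by apply: fNA => z Az; rewrite {1}(re _ Az) raddfN rmorphN.
have f1 := @fcalc_cst _ H A 1; rewrite scale1r in f1.
split; apply: (fcalc_unique ip_norm Asa _ f1).
  apply: fcalc_ext (fcalcM fA fNA) => z Az.
  by rewrite -rmorphM /= raddfN expRN divff// gt_eqF// expR_gt0.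
apply: fcalc_ext (fcalcM fNA fA) => z Az.
by rewrite -rmorphM /= raddfN expRN mulVf// gt_eqF// expR_gt0.
Qed.

(* With [A = log P / 2]. *)
Lemma op_exp_sqrt P : op_pos P -> (forall z, spectrum P z -> 1 <= complex.Re z) ->
  exists A, [/\ sa A, sa (op_exp A) & op_exp A * op_exp A = P].
Proof.
move=> Ppos P1; have [Psa _] := Ppos.
pose h (t : R) := ln (Num.max 1 t) / 2.
have [|A fA] := @fcalc_ex _ _ _ ip_norm P (fun z => (h (complex.Re z))%:C) Psa.
  apply: (@poly_approx_real _ h) => // e e0; have [K hK] := ln_max_modulus e0.
  exists K => x y _ _; have := hK x y; rewrite /h -mulrBl normrM.
  rewrite [`|2^-1|]ger0_norm ?invr_ge0// => le; apply: le_trans le.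
  by rewrite ler_piMr// invf_le1// ler1n.
have fE := exp_fcalc Psa fA (fun z _ => erefl).
exists A; split.
- exact: (fcalc_selfadjoint ip_norm Psa fA).
- exact: (fcalc_selfadjoint ip_norm Psa fE).
- apply: (fcalc_unique ip_norm Psa _ (fcalc_id P)).
  apply: fcalc_ext (fcalcM fE fE) => z Pz; rewrite /= -rmorphM /= -expRD /h.
  rewrite -splitr max_r ?P1// lnK; last by rewrite posrE (lt_le_trans ltr01)// P1.
  by case: (op_pos_spectrum Ppos Pz).
Qed.

End powers.

(** * Polar decomposition, Aluthge transform and numerical radius *)

Section polar_aluthge.
Context {R : realType} {H : completeNormedModType R[i]}.
Variable ip : {dot H for (@Num.conj R[i])}.
Hypothesis ip_norm : forall x : H, `|x| ^+ 2 = ip x x.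
Implicit Types (x y : H) (S T A B P U : bop H) (z c : R[i]).
Local Notation "T ^*'" := (adjoint ip T) (at level 2, format "T ^*'").

Lemma op_abs_pos T : op_pos ip (op_abs ip T).
Proof. by apply: (op_power_pos ip_norm (op_pos_adjointM ip_norm T)); apply/andP; lra. Qed.

Lemma op_abs_sqr T : op_abs ip T * op_abs ip T = T^*' * T.
Proof.
have pos := op_pos_adjointM ip_norm T.
rewrite /op_abs (op_powerD ip_norm pos); [|lra|lra|lra].
rewrite (_ : 2^-1 + 2^-1 = 1 :> R); last lra.
exact: op_power1 pos.
Qed.

Lemma rnorm_op_abs_apply T x : rnorm (op_abs ip T x) = rnorm (T x).
Proof.
apply/eqP; rewrite -(@eqrXn2 _ 2)// ?rnorm_ge0//; apply/eqP/complexI.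
have [Psa _] := op_abs_pos T.
rewrite -(selfadjoint_sqr ip_norm _ Psa) op_abs_sqr bop_mulE (adjointPr ip_norm).
exact: ipxx.
Qed.

Lemma rnorm_op_abs T : rnorm (op_abs ip T) <= rnorm T.
Proof.
apply: rnorm_bop_le => [|x]; first exact: rnorm_ge0.
by rewrite rnorm_op_abs_apply rnorm_apply.
Qed.

Lemma tends_rnorm (u : nat -> H) x : tends u x ->
  forall e : R, 0 < e -> exists N, forall n, (N <= n)%N -> `|rnorm (u n) - rnorm x| <= e.
Proof.
move=> ux e e0; have [N hN] := ux _ e0; exists N => n /hN h.
have := rnormD (u n - x) x; rewrite subrK.
have := rnormD (x - u n) (u n); rewrite subrK rnorm_distC => h1 h2.
by rewrite ler_norml; lra.
Qed.

(* [U] sends a limit of [|T| y_n] to the limit of [T y_n], which exists as [|T y| = ||T| y|], and kills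
   the orthogonal complement of the range of [|T|]. *)
Lemma polar_ex T : exists U : bop H,
  [/\ T = U * op_abs ip T, partial_isometry ip U & op_ker U = op_ker T].
Proof.
set P := op_abs ip T; have [Psa _] := op_abs_pos T; rewrite -/P in Psa.
have PT x : rnorm (P x) = rnorm (T x) by exact: rnorm_op_abs_apply.
(* The closure of the range of [P] = |T|, each point carrying an approximating sequence whose images
   under [T] also converge. *)
pose M := [set m | exists2 y : nat -> H, tends (fun n => P (y n)) m &
                                         exists v, tends (fun n => T (y n)) v].
have TP (y : nat -> H) m : tends (fun n => P (y n)) m -> exists v, tends (fun n => T (y n)) v.
  move=> ym; apply: cauchy_tends => e e0.
  have [N hN] := tends_cauchy ym e0; exists N => k n Nk Nn.
  by rewrite -linearB /= -PT linearB hN.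
have close (m : H) : (forall e : R, 0 < e -> exists y, rnorm (P y - m) <= e) -> M m.
  move=> h.
  have [y hy] := choice (fun n : nat => h n.+1%:R^-1 ltac:(by rewrite invr_gt0)).
  have ym : tends (fun n => P (y n)) m.
    move=> e e0; have := @near_infty_natSinv_lt R (PosNum e0).
    by case=> N _ hN; exists N => n /hN /ltW; exact: le_trans (hy n).
  by exists y => //; exact: TP ym.
have Mlin c x y : M x -> M y -> M (c *: x + y).
  move=> [u ux _] [v vy _].
  have w : tends (fun n => P (c *: u n + v n)) (c *: x + y).
    by apply: tends_eq (tendsD (tendsZ c ux) vy) => n; rewrite linearP.
  by exists (fun n => c *: u n + v n) => //; exact: TP w.
have M0 : M 0.
  by apply: close => e e0; exists 0; rewrite linear0 subrr rnorm0 ltW.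
have MP y : M (P y).
  by apply: close => e e0; exists y; rewrite subrr rnorm0 ltW.
have Mcl (u : nat -> H) l : (forall n, M (u n)) -> tends u l -> M l.
  move=> Mu ul; apply: close => e e0; have e2 : 0 < e / 2 by rewrite divr_gt0.
  have [N hN] := ul _ e2; have [y yu _] := Mu N; have [N' hN'] := yu _ e2.
  exists (y N'); rewrite (le_trans (rnorm_triangle (u N) _ _))//.
  by rewrite [leRHS]splitr lerD ?hN ?hN'.
(* The graph of the future [U]: m is the orthogonal projection of [x] on [M], and v the limit of T
   y_n. [Gsub] shows it linear and [Gle] contractive, which together make it single-valued. *)
pose G x v := exists m (y : nat -> H), [/\ forall y', ip (x - m) (P y') = 0,
  tends (fun n => P (y n)) m & tends (fun n => T (y n)) v].
have Gex x : exists v, G x v.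
  have [m [y ym [v yv]] orth] := projection ip_norm M0 Mlin Mcl x.
  by exists v, m, y; split=> // y'; exact: orth.
have orthM k : (forall y', ip k (P y') = 0) -> forall m, M m -> ip k m = 0.
  move=> kP m [y ym _]; apply: (tends_ip_eq ip_norm (tends_cst k) ym) => n.
  exact: kP.
have Gnorm x v : G x v -> exists m, [/\ M m, forall y', ip (x - m) (P y') = 0 & rnorm v = rnorm m].
  move=> [m [y [orth ym yv]]]; exists m; split=> //; first by exists y => //; exists v.
  apply/eqP; rewrite -subr_eq0 -normr_eq0; apply/eqP/le_anti; rewrite normr_ge0 andbT.
  apply/ler_addgt0Pr => e e0; rewrite add0r; have e2 : 0 < e / 2 by rewrite divr_gt0.
  have [N hN] := tends_rnorm ym e2; have [N' hN'] := tends_rnorm yv e2.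
  have h1 := hN _ (leq_maxl N N'); have h2 := hN' _ (leq_maxr N N').
  rewrite -PT in h2; move: h1 h2; rewrite !ler_norml; lra.
have Gsub x v x' v' c : G x v -> G x' v' -> G (c *: x + x') (c *: v + v').
  move=> [m [y [orth ym yv]]] [m' [y' [orth' ym' yv']]].
  exists (c *: m + m'), (fun n => c *: y n + y' n); split.
  - move=> w; rewrite opprD addrACA -scalerBr ipDl ipZl orth orth'.
    by rewrite mulr0 addr0.
  - by apply: tends_eq (tendsD (tendsZ c ym) ym') => n; rewrite linearP.
  - by apply: tends_eq (tendsD (tendsZ c yv) yv') => n; rewrite linearP.
have pyth x m : (forall y', ip (x - m) (P y') = 0) -> M m -> rnorm x ^+ 2 = rnorm (x - m) ^+ 2 + rnorm m ^+ 2.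
  move=> orth Mm; have := sqr_rnormD ip_norm (x - m) m.
  by rewrite subrK (orthM _ orth _ Mm) mulr0 addr0.
have Gle x v : G x v -> rnorm v <= rnorm x.
  move=> /Gnorm[m [Mm orth ->]].
  rewrite -(@ler_pXn2r _ 2)// ?nnegrE ?rnorm_ge0// (pyth _ _ orth Mm) lerDr.
  by rewrite exprn_ge0// rnorm_ge0.
have Guniq x v v' : G x v -> G x v' -> v = v'.
  move=> xv xv'; have := Gle _ _ (Gsub _ _ _ _ (-1) xv xv').
  rewrite !scaleN1r addNr rnorm0 => le.
  apply/eqP; rewrite eq_sym -subr_eq0; apply/eqP/rnorm_eq0/le_anti.
  by rewrite rnorm_ge0 andbT addrC.
have [f hf] := choice Gex.
have [c x y|x|U UE] := @bop_of _ _ f 1.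
- exact: Guniq (hf _) (Gsub _ _ _ _ c (hf x) (hf y)).
- by rewrite mul1r Gle.
have kerE x : U x = 0 <-> T x = 0.
  have [m [Mm orth e]] := Gnorm _ _ (hf x); split=> [Ux0|Tx0].
    have m0 : m = 0 by apply: rnorm_eq0; rewrite -e -UE Ux0 rnorm0.
    rewrite m0 subr0 in orth.
    apply: rnorm_eq0; rewrite -PT; have -> : P x = 0; last exact: rnorm0.
    by apply: (ip_eq0 ip_norm) => y; rewrite -(selfadjointP ip_norm _ _ Psa) ip_conj orth rmorph0.
  have Px0 : P x = 0 by apply: rnorm_eq0; rewrite PT Tx0 rnorm0.
  have xP y' : ip x (P y') = 0 by rewrite -(selfadjointP ip_norm _ _ Psa) Px0 ip0l.
  have := pyth _ _ orth Mm; rewrite (sqr_rnormB ip_norm) (orthM _ xP _ Mm) mulr0 subr0 => h.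
  rewrite UE; apply: rnorm_eq0; rewrite e; apply/eqP; rewrite -sqrf_eq0.
  by apply/eqP; have := sqr_ge0 (rnorm m); lra.
exists U; split.
- apply/bopP => y; rewrite bop_mulE UE; apply: (Guniq (P y)) => //.
  by exists (P y), (fun=> y); split=> [y'||]; [rewrite subrr ip0l|exact: tends_cst|exact: tends_cst].
- move=> x xker; have [m [Mm orth e]] := Gnorm _ _ (hf x).
  have km : U (x - m) = 0.
    apply/kerE/rnorm_eq0; rewrite -PT; have -> : P (x - m) = 0; last exact: rnorm0.
    by apply: (ip_eq0 ip_norm) => y; rewrite -(selfadjointP ip_norm _ _ Psa) ip_conj orth rmorph0.
  (* x - m is orthogonal to m because m is in [M], and to [x] because x - m is in the kernel of [U];
     hence x = m, where [U] preserves the norm. *)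
  have : ip (x - m) (x - m) = 0.
    by rewrite ipBr (orthM _ orth _ Mm) subr0 ip_conj (xker _ km) rmorph0.
  rewrite (ipxx ip_norm) => /complexI /eqP; rewrite sqrf_eq0 => /eqP/rnorm_eq0/eqP.
  by rewrite subr_eq0 => /eqP xm; rewrite -!rnormE UE e -xm.
- by apply/seteqP; split=> x /=; rewrite /op_ker /= kerE.
Qed.

Lemma polar_isometryP T : T = polar_isometry ip T * op_abs ip T /\ rnorm (polar_isometry ip T) <= 1.
Proof.
pose Q := [set U : bop H |
    [/\ T = U * op_abs ip T, partial_isometry ip U & op_ker U = op_ker T]].
have [TE iso _] : Q (polar_isometry ip T) by apply: getPex; exact: polar_ex.
split=> //; set U := polar_isometry ip T in TE iso *.
apply: rnorm_bop_le => [//|x]; rewrite mul1r.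
(* Projecting on the kernel of [U] leaves x - m in its orthogonal complement, where [U] is
   isometric, and |x - m| <= |x|. *)
have [|c u v||m /= Um orth] := projection ip_norm (M := op_ker U) _ _ _ x.
- by rewrite /op_ker /= linear0.
- by rewrite /op_ker /= => u0 v0; rewrite linearP /= u0 v0 scaler0 addr0.
- rewrite /op_ker /= => u l u0 ul; apply: tends_unique (tends_bop U ul) _.
  by apply: tends_eq (tends_cst 0) => n; rewrite u0.
have e : U x = U (x - m) by rewrite linearB /= Um subr0.
have -> : rnorm (U x) = rnorm (x - m).
  by rewrite e; apply: complexI; rewrite !rnormE; apply: iso => y /orth.
rewrite -(@ler_pXn2r _ 2)// ?nnegrE ?rnorm_ge0//.
have := sqr_rnormD ip_norm (x - m) m; rewrite subrK orth// mulr0 addr0 => ->.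
rewrite lerDl.
by rewrite exprn_ge0// rnorm_ge0.
Qed.

Lemma rnorm_aluthge (a : R) T : 0 <= a <= 1 -> rnorm (aluthge ip a T) <= rnorm T.
Proof.
move=> a01; have /andP[a0 a1] := a01; rewrite (le_trans _ (rnorm_op_abs T))//.
have [_ U1] := polar_isometryP T; have pos := op_abs_pos T.
have h1 := rnorm_op_power ip_norm pos a01.
have h2 := @rnorm_op_power _ _ _ ip_norm _ (1 - a) pos ltac:(apply/andP; lra).
rewrite /aluthge (le_trans (rnorm_mul _ _))//.
have -> : rnorm (op_abs ip T) = rnorm (op_abs ip T) `^ a * rnorm (op_abs ip T) `^ (1 - a).
  rewrite -powRD; first by rewrite addrCA subrr addr0 powRr1// rnorm_ge0.
  by rewrite addrCA subrr addr0 oner_eq0.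
rewrite ler_pM ?rnorm_ge0// (le_trans (rnorm_mul _ _))//.
by rewrite (le_trans _ h1)// ler_piMr ?rnorm_ge0.
Qed.

Lemma spectrum_aluthge (a : R) T z : 0 <= a <= 1 -> z != 0 -> spectrum T z ->
  spectrum (aluthge ip a T) z.
Proof.
move=> /andP[a0 a1] z0; have [TE _] := polar_isometryP T; have pos := op_abs_pos T.
rewrite {1}TE -{1}(op_power1 ip_norm pos).
have -> : op_power (op_abs ip T) 1 = op_power (op_abs ip T) (1 - a) * op_power (op_abs ip T) a.
  by rewrite (op_powerD ip_norm pos) ?subr_ge0// subrK.
by rewrite mulrA => /(spectrum_mulC z0); rewrite mulrA.
Qed.

Lemma rnorm_iter_aluthge (a : R) n T : 0 <= a <= 1 -> rnorm (iter n (aluthge ip a) T) <= rnorm T.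
Proof.
by move=> a01; elim: n => [//|n IH]; rewrite iterS (le_trans (rnorm_aluthge _ a01)).
Qed.

Lemma spectrum_iter_aluthge (a : R) n T z : 0 <= a <= 1 -> z != 0 -> spectrum T z ->
  spectrum (iter n (aluthge ip a) T) z.
Proof.
by move=> a01 z0 Tz; elim: n => [//|n IH]; rewrite iterS; exact: spectrum_aluthge.
Qed.

Lemma numerical_range_bound T z : numerical_range ip T z -> cnorm z <= rnorm T.
Proof.
move=> [x /= x1 <-]; have rx : rnorm x = 1 by rewrite /rnorm x1.
rewrite (le_trans (cauchy_schwarz ip_norm _ _))// rx mulr1.
by rewrite (le_trans (rnorm_apply _ _))// rx mulr1.
Qed.

Lemma numerical_radius_le T (M : R) : 0 <= M -> rnorm T <= M -> numerical_radius ip T <= M.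
Proof.
move=> M0 TM; rewrite /numerical_radius; set D := (X in sup X).
have [D0|/nonemptyPn D0] := pselect (D !=set0); last by rewrite D0 sup0.
apply: ge_sup => // _ [z Tz <-].
exact: le_trans (numerical_range_bound Tz) TM.
Qed.

Lemma numerical_radius_ub T x : cnorm (ip (T x) x) <= numerical_radius ip T * rnorm x ^+ 2.
Proof.
have [->|x0] := eqVneq x 0; first by rewrite ip0r cnorm0 rnorm0 expr0n mulr0.
have rx := rnorm_gt0 x0; set r := rnorm x in rx *.
pose u := (r^-1)%:C *: x.
have u1 : `|u| = 1.
  by rewrite -rnormE /u rnormZ cnorm_real gtr0_norm ?invr_gt0// mulVf// gt_eqF.
have : cnorm (ip (T u) u) <= numerical_radius ip T.
  apply: sup_upper_bound; last by exists (ip (T u) u) => //; exists u.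
  split; first by exists (cnorm (ip (T u) u)), (ip (T u) u) => //; exists u.
  by exists (rnorm T) => _ [z Tz <-]; exact: numerical_range_bound Tz.
have TZ : T u = (r^-1)%:C *: T x by rewrite linearZ.
rewrite TZ /u ipZl ipZr conj_real !cnormM cnorm_real gtr0_norm ?invr_gt0//.
by rewrite !ler_pdivrMl// mulrA -expr2 [leRHS]mulrC.
Qed.

Lemma numerical_radius_ge0 T : 0 <= numerical_radius ip T.
Proof.
rewrite /numerical_radius; set D := (X in sup X).
have [[? [z Tz _]]|/nonemptyPn D0] := pselect (D !=set0); last by rewrite D0 sup0.
rewrite (le_trans (cnorm_ge0 z))//; apply: sup_upper_bound; last by exists z.
split; first by exists (cnorm z), z.
by exists (rnorm T) => _ [w Tw <-]; exact: numerical_range_bound Tw.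
Qed.

(** If |z| exceeds the numerical radius w, the operator -conj(z) (T - z) is coercive: the real part
    of its form is |z|^2 |x|^2 - Re (conj(z) <T x, x>) >= |z| (|z| - w) |x|^2. *)
Lemma spectrum_le_numerical_radius T z : spectrum T z -> cnorm z <= numerical_radius ip T.
Proof.
move=> Tz; rewrite leNgt; apply/negP => wz; apply: Tz.
have w0 := numerical_radius_ge0 T; have cz : 0 < cnorm z by lra.
have z0 : z != 0 by apply: contraTneq cz => ->; rewrite cnorm0 ltxx.
have nz0 : - Num.conj z != 0 by rewrite oppr_eq0 conjC_eq0.
apply/(op_invertibleZ_iff _ nz0).
apply: (coercive_invertible ip_norm (d := cnorm z * (cnorm z - numerical_radius ip T))).
  by rewrite mulr_gt0// subr_gt0.
move=> x; rewrite !bopE ipZl ipBl ipZl (ipxx ip_norm).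
have -> : - Num.conj z * (ip (T x) x - z * (rnorm x ^+ 2)%:C) =
    (cnorm z ^+ 2 * rnorm x ^+ 2)%:C - Num.conj z * ip (T x) x.
  have -> : (cnorm z ^+ 2 * rnorm x ^+ 2)%:C = Num.conj z * z * (rnorm x ^+ 2)%:C.
    by rewrite conjM_cnorm -rmorphM.
  ring.
have h1 := Re_cnorm (Num.conj z * ip (T x) x); rewrite cnormM in h1.
rewrite -[cnorm (Num.conj z)]/(cnorm z^*) cnorm_conj in h1.
have h2 := ler_wpM2l (ltW cz) (numerical_radius_ub T x).
by rewrite raddfB /=; lra.
Qed.

End polar_aluthge.

(** * Gelfand's bound on the powers of an operator *)

Section gelfand.
Context {R : realType} {H : completeNormedModType R[i]}.
Implicit Types (S T G : bop H) (s z w : R[i]).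

Lemma cnorm_le_ReIm z : cnorm z <= `|complex.Re z| + `|complex.Im z|.
Proof.
rewrite -(@ler_pXn2r _ 2)// ?nnegrE ?cnorm_ge0 ?addr_ge0// sqr_cnorm.
rewrite -(real_normK (num_real (complex.Re z))) -(real_normK (num_real (complex.Im z))).
have := normr_ge0 (complex.Re z); have := normr_ge0 (complex.Im z); nra.
Qed.

Lemma cnorm_ReIm_le z (r : R) : cnorm z <= r -> `|complex.Re z| <= r /\ `|complex.Im z| <= r.
Proof.
move=> zr; have r0 : 0 <= r := le_trans (cnorm_ge0 z) zr.
have h := sqr_cnorm z.
have le u : u ^+ 2 <= cnorm z ^+ 2 -> `|u| <= r.
  move=> uz; rewrite (le_trans _ zr)// -(@ler_pXn2r _ 2)// ?nnegrE ?cnorm_ge0//.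
  by rewrite real_normK// num_real.
by split; apply: le; rewrite h ?lerDl ?lerDr sqr_ge0.
Qed.

Lemma resolvent_identity T s s' G G' : op_inverse (1 - s *: T) G -> op_inverse (1 - s' *: T) G' ->
  G - G' = (s - s') *: (G * T * G').
Proof.
move=> [_ h] [h' _].
have : G * ((1 - s' *: T) - (1 - s *: T)) * G' = G - G'.
  by rewrite mulrBr h mulrBl mul1r -mulrA h' mulr1.
rewrite opprB addrC addrA subrK -scalerBl => <-.
by rewrite bop_scaleAr bop_scaleAl.
Qed.

(** In G = G' + (s - s') G T G', a distance |s - s'| <= 1 / K makes the last term at most |G| / 2,
    which is absorbed on the left. *)
Lemma resolvent_local_bound T s' G' : op_inverse (1 - s' *: T) G' ->
  exists2 d : R, 0 < d & forall s G, cnorm (s - s') <= d -> op_inverse (1 - s *: T) G ->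
    rnorm G <= 2 * rnorm G'.
Proof.
move=> hG'; have T0 := rnorm_ge0 T; have G0 := rnorm_ge0 G'.
pose K := 2 * (rnorm T * rnorm G' + 1).
have K0 : 0 < K by rewrite /K mulr_gt0// ltr_wpDl// mulr_ge0.
exists K^-1; rewrite ?invr_gt0// => s G sd hG.
have e := resolvent_identity hG hG'.
have : rnorm G <= rnorm G' + cnorm (s - s') * (rnorm G * rnorm T * rnorm G').
  have {1}-> : G = G' + (s - s') *: (G * T * G') by rewrite -e addrC subrK.
  rewrite (le_trans (rnormD _ _))// lerD2l rnormZ ler_wpM2l ?cnorm_ge0//.
  by rewrite (le_trans (rnorm_mul _ _))// ler_wpM2r ?rnorm_ge0// rnorm_mul.
have q : cnorm (s - s') * K <= 1 by rewrite -ler_pdivlMr// div1r.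
have : 0 <= cnorm (s - s') := cnorm_ge0 _.
have : 0 <= rnorm G := rnorm_ge0 G.
rewrite /K in q => g0 c0 h.
have : cnorm (s - s') * (rnorm T * rnorm G') <= 1 / 2 by lra.
move=> h2; have : cnorm (s - s') * (rnorm T * rnorm G') * rnorm G <= 1 / 2 * rnorm G.
  by rewrite ler_wpM2r.
lra.
Qed.

(** Compactness turns the local bounds into one. The disc is placed in the square [-r, r]^2, whose
    points outside the disc have a neighbourhood that misses it, so that [P] holds vacuously
    there. *)
Lemma resolvent_bound T (r : R) : (forall s, cnorm s <= r -> op_invertible (1 - s *: T)) ->
  exists M : R, forall s G, cnorm s <= r -> op_inverse (1 - s *: T) G -> rnorm G <= M.
Proof.
move=> inv; pose D := `[- r, r]%classic `*` `[- r, r]%classic : set (R * R).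
have cD : compact D by apply: compact_setX; exact: segment_compact.
pose P (n : nat) (ab : R * R) := forall G, cnorm (ab.1 +i* ab.2) <= r ->
  op_inverse (1 - (ab.1 +i* ab.2) *: T) G -> rnorm G <= n%:R.
have diff (x y : R * R) (d : R) : ball x d y ->
    cnorm ((y.1 +i* y.2) - (x.1 +i* x.2)) <= 2 * d.
  move=> [/ltW h1 /ltW h2]; rewrite (le_trans (cnorm_le_ReIm _))//=.
  by rewrite mulr_natl mulr2n lerD// distrC.
have := (compact_near_coveringP D).1 cD nat \oo P _.
move=> [x _|N _ /(_ N (leqnn N)) hN].
  have [xr|xr] := leP (cnorm (x.1 +i* x.2)) r.
    have [G' hG'] := inv _ xr; have [d d0 hd] := resolvent_local_bound hG'.
    have [n hn] : exists n : nat, 2 * rnorm G' <= n%:R.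
      by exists (Num.trunc (2 * rnorm G')).+1; rewrite ltW// truncnS_gt.
    exists (ball x (d / 2), [set m | (n <= m)%N]) => /=.
      by split; [apply: nbhsx_ballx; rewrite divr_gt0|exists n].
    move=> [y m] /= [xy nm] G _ hG; rewrite (le_trans (hd _ _ _ hG))//.
      by rewrite (le_trans (diff _ _ _ xy))// mulrC divfK.
    by rewrite (le_trans hn)// ler_nat.
  pose d := cnorm (x.1 +i* x.2) - r; have d0 : 0 < d by rewrite subr_gt0.
  exists (ball x (d / 4), setT) => /=.
    by split; [apply: nbhsx_ballx; rewrite divr_gt0|exact: filterT].
  move=> [y m] /= [xy _] G yr; exfalso.
  have h := diff _ _ _ xy.
  have := cnormB (y.1 +i* y.2) ((y.1 +i* y.2) - (x.1 +i* x.2)).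
  have {}yr : cnorm (y.1 +i* y.2) <= r := yr.
  by rewrite subKr; rewrite /d in h d0; lra.
exists N%:R => s G sr hG.
case: s sr hG => a b sr hG; have [ha hb] := cnorm_ReIm_le sr.
apply: (hN (a, b)) => //; split; rewrite /= in_itv/=.
  by rewrite -ler_norml.
by rewrite -ler_norml.
Qed.

Lemma root_of_unity (n : nat) : (0 < n)%N -> exists2 w : R[i], w ^+ n = -1 & cnorm w = 1.
Proof.
move=> n0; exists (n.-root (-1)); first exact: rootCK.
apply/eqP; rewrite -(@eqrXn2 _ n)// ?cnorm_ge0// expr1n -cnormX rootCK//.
by rewrite cnormN cnorm1.
Qed.

(** Partial fractions: 2 / (1 - S^2) = 1 / (1 - S) + 1 / (1 + S). *)
Lemma inverse_1B_sqr S G1 G2 : op_inverse (1 - S) G1 -> op_inverse (1 + S) G2 ->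
  op_inverse (1 - S * S) ((2^-1 : R[i]) *: (G1 + G2)).
Proof.
move=> [a1 b1] [a2 b2].
have e1 : 1 - S * S = (1 + S) * (1 - S) by rewrite mulrDl mul1r mulrBr mulr1 addrA subrK.
have e2 : 1 - S * S = (1 - S) * (1 + S) by rewrite mulrBl mul1r mulrDr mulr1 opprD addrA addrK.
have half : (2^-1 : R[i]) *: ((1 + S) + (1 - S)) = 1.
  by rewrite addrACA subrr addr0 half_half.
split.
  rewrite bop_scaleAr mulrDr {1}e1 e2 -!mulrA a1 a2 !mulr1; exact: half.
by rewrite bop_scaleAl mulrDl {1}e2 e1 !mulrA b1 b2 !mul1r half.
Qed.

(* [(1 - s^(2^k) T^(2^k))^-1] is the average of [(1 - w s T)^-1] over the [2^k]-th roots of unity [w], so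
   its modulus of continuity in [s] does not depend on [k]. *)
Lemma resolvent_power_unif T (r d e : R) :
  (forall s s', cnorm s <= r -> cnorm s' <= r -> cnorm (s - s') <= d ->
    exists G G', [/\ op_inverse (1 - s *: T) G, op_inverse (1 - s' *: T) G' & rnorm (G - G') <= e]) ->
  forall k s s', cnorm s <= r -> cnorm s' <= r -> cnorm (s - s') <= d ->
    exists G G', [/\ op_inverse (1 - (s *: T) ^+ (2 ^ k)) G,
      op_inverse (1 - (s' *: T) ^+ (2 ^ k)) G' & rnorm (G - G') <= e].
Proof.
move=> h; elim=> [|k IH] s s' sr s'r ss'; first by rewrite expn0 !expr1; exact: h.
(* As w^(2^k) = -1, replacing s by w s changes the sign of (s T)^(2^k), while |w| = 1 preserves the
   bounds on s, s' and s - s'. *)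
have [w wn w1] := @root_of_unity (2 ^ k) ltac:(by rewrite expn_gt0).
have [G1 [G1' [i1 i1' d1]]] := IH s s' sr s'r ss'.
have [|||G2 [G2' [i2 i2' d2]]] := IH (w * s) (w * s').
- by rewrite cnormM w1 mul1r.
- by rewrite cnormM w1 mul1r.
- by rewrite -mulrBr cnormM w1 mul1r.
rewrite -!scalerA !(bop_exprZ w) wn !scaleN1r !opprK in i2 i2'.
exists ((2^-1 : R[i]) *: (G1 + G2)), ((2^-1 : R[i]) *: (G1' + G2')); split.
- by rewrite expnSr muln2 -addnn exprD; exact: inverse_1B_sqr.
- by rewrite expnSr muln2 -addnn exprD; exact: inverse_1B_sqr.
- rewrite -scalerBr rnormZ cnormV cnorm_nat opprD addrACA.
  have := rnormD (G1 - G1') (G2 - G2'); lra.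
Qed.

(** |S| <= 1/5 gives |G - 1| <= (|G - 1| + 1) / 5, so |G - 1| <= 1/4 and |G' - 1| <= 1/4 + 1/5 <
    1/2; then S' = (G' - 1) - (G' - 1) S' forces |S'| < 1. The constant 5 serves to keep this sum
    below 1/2. *)
Lemma power_step S S' G G' : op_inverse (1 - S) G -> op_inverse (1 - S') G' ->
  5 * rnorm S <= 1 -> 5 * rnorm (G - G') <= 1 -> rnorm S' < 1.
Proof.
move=> [_ h] [_ h'] S5 GG'.
have GE : G - 1 = G * S.
  have e : G - G * S = 1 by rewrite -h mulrBr mulr1.
  by rewrite -e subKr.
have S'E : S' = (G' - 1) - (G' - 1) * S'.
  have e : G' - G' * S' = 1 by rewrite -h' mulrBr mulr1.
  by rewrite mulrBl mul1r opprB [S' - _]addrC addrACA e addrA subrr add0r.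
have g1 : rnorm (G - 1) <= rnorm G * rnorm S by rewrite GE rnorm_mul.
have g2 : rnorm G <= rnorm (G - 1) + 1.
  by rewrite -{1}(subrK 1 G) (le_trans (rnormD _ _))// lerD2l rnorm_bop1.
have g3 : rnorm (G' - 1) <= rnorm (G - G') + rnorm (G - 1).
  by rewrite (rnorm_distC G) (le_trans (rnorm_triangle G _ _)).
have g4 : rnorm S' <= rnorm (G' - 1) + rnorm (G' - 1) * rnorm S'.
  by rewrite {1}S'E (le_trans (rnormB _ _))// lerD2l rnorm_mul.
move: (rnorm_ge0 G) (rnorm_ge0 S) (rnorm_ge0 S') S5 GG' g1 g2 g3 g4.
move: (rnorm G) (rnorm S) (rnorm S') (rnorm (G - G')) (rnorm (G - 1)) (rnorm (G' - 1)) => {h h' GE S'E}.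
move=> a b b' d u u' a0 b0 b'0 b5 d5 ab au u'u b'u'.
have ab5 : a * (5 * b) <= a by rewrite ler_piMr.
have u'2 : 2 * u' < 1 by lra.
have : 2 * u' * b' <= b' by rewrite ler_piMl// ltW.
lra.
Qed.

Lemma power_small S (e : R) : 0 < e -> rnorm S < 1 ->
  exists k, rnorm (S ^+ (2 ^ k)) <= e.
Proof.
move=> e0 S1; have S0 := rnorm_ge0 S.
have : (fun n => rnorm S ^+ n) @ \oo --> (0 : R) by apply: cvg_expr; rewrite ger0_norm.
move=> /cvgrPdist_le /(_ _ e0)[N _ hN].
exists N; rewrite (le_trans (rnorm_exp _ _))//.
have := hN (2 ^ N)%N; rewrite /= sub0r normrN ger0_norm ?exprn_ge0//.
by apply; apply: ltnW; exact: ltn_expl.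
Qed.

Lemma gelfand_upper T (c : R) : 0 < c -> (forall z, spectrum T z -> cnorm z < c) ->
  exists2 m, (0 < m)%N & rnorm (T ^+ m) <= c ^+ m.
Proof.
move=> c0 hc; pose r := c^-1; have r0 : 0 < r by rewrite invr_gt0.
have inv s : cnorm s <= r -> op_invertible (1 - s *: T).
  move=> sr; have [->|s0] := eqVneq s 0.
    by rewrite scale0r subr0; exact: op_invertible1.
  have -> : 1 - s *: T = (- s) *: (T - s^-1 *: (1 : bop H)).
    by rewrite scalerBr scalerA mulNr divff// scaleN1r opprK scaleNr addrC.
  apply: op_invertibleZ; first by rewrite oppr_eq0.
  apply: contrapT => /hc; rewrite cnormV ltNge => /negP; apply.
  have sp : 0 < cnorm s by rewrite lt_def cnorm_ge0 andbT; apply: contra_neq s0; exact: cnorm_eq0.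
  by rewrite -[c]invrK lef_pV2// posrE.
have [M hM] := resolvent_bound inv.
have M0 : 0 <= `|M| by [].
have T0 := rnorm_ge0 T.
(* By the resolvent identity, |s - s'| <= 1 / K keeps the resolvents within 1/5 of each other, as
   [power_step] requires. *)
pose K := 5 * (`|M| * rnorm T * `|M| + 1).
have K0 : 0 < K by rewrite /K mulr_gt0// ltr_wpDl// !mulr_ge0.
pose d := K^-1; have d0 : 0 < d by rewrite invr_gt0.
have unif s s' : cnorm s <= r -> cnorm s' <= r -> cnorm (s - s') <= d ->
    exists G G', [/\ op_inverse (1 - s *: T) G, op_inverse (1 - s' *: T) G' & rnorm (G - G') <= 5^-1].
  move=> sr s'r ss'; have [G hG] := inv _ sr; have [G' hG'] := inv _ s'r.
  exists G, G'; split=> //; rewrite (resolvent_identity hG hG') rnormZ.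
  have G1 := le_trans (hM _ _ sr hG) (ler_norm M).
  have G'1 := le_trans (hM _ _ s'r hG') (ler_norm M).
  have h1 : rnorm (G * T * G') <= `|M| * rnorm T * `|M|.
    rewrite (le_trans (rnorm_mul _ _))// ler_pM ?rnorm_ge0//.
    by rewrite (le_trans (rnorm_mul _ _))// ler_pM ?rnorm_ge0.
  have q : cnorm (s - s') * K <= 1 by rewrite -ler_pdivlMr// div1r.
  have c1 := cnorm_ge0 (s - s').
  rewrite -div1r ler_pdivlMr// mulrC.
  have := ler_wpM2l c1 h1; rewrite /K in q; lra.
have unifk := resolvent_power_unif unif.
(* The property carried from t = 0 to t = r = 1 / c in steps of length at most d. Each step first
   raises the exponent with [power_small], from norm below 1 to norm at most 1/5; d stays the same
   for all exponents. *)
pose A (t : R) := exists k, rnorm ((t%:C *: T) ^+ (2 ^ k)) < 1.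
have step t t' : 0 <= t -> t <= r -> 0 <= t' -> t' <= r -> `|t - t'| <= d -> A t -> A t'.
  move=> t0 tr t'0 t'r tt' [k hk].
  have [j hj] := @power_small _ 5^-1 ltac:(by rewrite invr_gt0) hk.
  have [|||G [G' [i i' h]]] := unifk (k + j)%N t%:C t'%:C.
  - by rewrite cnorm_real ger0_norm.
  - by rewrite cnorm_real ger0_norm.
  - by rewrite -rmorphB cnorm_real.
  have five u : u <= 5^-1 -> 5 * u <= 1 :> R by move=> u5; rewrite mulrC -ler_pdivlMr// div1r.
  exists (k + j)%N; apply: (power_step i i'); last exact: five.
  by apply: five; rewrite expnD exprM.
have A0 : A 0.
  by exists 0%N; rewrite expn0 expr1 scale0r rnorm0.
have Aj j : A (Num.min (j%:R * d) r).
  elim: j => [|j IH]; first by rewrite mul0r min_l// ltW.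
  apply: step IH; rewrite ?ge_min ?lexx ?orbT// ?le_min ?(ltW r0) ?andbT.
  - by rewrite mulr_ge0// ltW.
  - by rewrite mulr_ge0// ltW.
  - rewrite -natr1 mulrDl mul1r ler_norml.
    have [h1|h1] := leP (j%:R * d) r; have [h2|h2] := leP (j%:R * d + d) r; lra.
have [k hk] : A r.
  have [j hj] : exists j : nat, r / d <= j%:R.
    by exists (Num.trunc (r / d)).+1; rewrite ltW// truncnS_gt.
  by have := Aj j; rewrite min_r// -ler_pdivrMr.
exists (2 ^ k)%N; first by rewrite expn_gt0.
move: hk; rewrite bop_exprZ rnormZ cnormX cnorm_real gtr0_norm// /r exprVn.
by rewrite ltr_pdivrMl ?exprn_gt0// mulr1 => /ltW.
Qed.

End gelfand.

(** * Similarity to a contraction *)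

Section rota.
Context {R : realType} {H : completeNormedModType R[i]}.
Variable ip : {dot H for (@Num.conj R[i])}.
Hypothesis ip_norm : forall x : H, `|x| ^+ 2 = ip x x.
Implicit Types (x y : H) (S T A B P X Y : bop H).
Local Notation "T ^*'" := (adjoint ip T) (at level 2, format "T ^*'").

Lemma ip_suml (I : Type) (r : seq I) (F : I -> H) x :
  ip (\sum_(i <- r) F i) x = \sum_(i <- r) ip (F i) x.
Proof. by apply: (big_morph (ip^~ x)) => [u v|]; [exact: ipDl|exact: ip0l]. Qed.

(* If [|S^m| <= 1], then [S] is a contraction for the equivalent norm
   [sum_(k < m) |S^k x|^2 = |X x|^2], where [X^2 = sum_(k < m) (S^k)^* S^k]. *)
Lemma similar_to_contraction S m : (0 < m)%N -> rnorm (S ^+ m) <= 1 ->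
  exists2 A, selfadjoint ip A & forall x, rnorm (op_exp A (S x)) <= rnorm (op_exp A x).
Proof.
case: m => // m _ Sm.
pose P := \sum_(k < m.+1) (S ^+ k)^*' * S ^+ k.
have PE x y : ip (P x) y = \sum_(k < m.+1) ip ((S ^+ k) x) ((S ^+ k) y).
  rewrite /P bop_sumE ip_suml; apply: eq_bigr => k _.
  by rewrite bop_mulE (adjointPr ip_norm).
have Psa : selfadjoint ip P.
  apply: (selfadjoint_of ip_norm) => x y; rewrite PE ip_conj PE rmorph_sum.
  by apply: eq_bigr => k _; exact: ip_conj.
pose q x := \sum_(k < m.+1) rnorm ((S ^+ k) x) ^+ 2.
have Pq x : ip (P x) x = (q x)%:C.
  rewrite PE /q rmorph_sum; apply: eq_bigr => k _; exact: ipxx.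
have q1 x : rnorm x ^+ 2 <= q x.
  rewrite /q big_ord_recl expr0 bop_oneE lerDl.
  by apply: sumr_ge0 => k _; rewrite exprn_ge0// rnorm_ge0.
have Ppos : op_pos ip P.
  by split=> // x; rewrite Pq /= (le_trans _ (q1 x))// exprn_ge0// rnorm_ge0.
(* The term k = 0 gives <P x, x> >= |x|^2, so the spectrum of [P] lies where the logarithm is
   taken. *)
have [|A [Asa Xsa XX]] := op_exp_sqrt ip_norm Ppos.
  by move=> z; apply: (spectrum_ge ip_norm) => x; rewrite mul1r Pq.
exists A => // x; have Xq y : rnorm (op_exp A y) ^+ 2 = q y.
  by apply: complexI; rewrite -(selfadjoint_sqr ip_norm _ Xsa) XX.
rewrite -(@ler_pXn2r _ 2)// ?nnegrE ?rnorm_ge0// !Xq /q.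
(* Replacing x by S x shifts the sum: the term |x|^2 is lost and |S^(m+1) x|^2 is gained, [m] being
   now the predecessor of the original exponent. *)
rewrite [leRHS]big_ord_recl big_ord_recr /= addrC lerD//.
  rewrite ?expr0 ?bop_oneE ler_pXn2r// ?nnegrE ?rnorm_ge0//.
  rewrite -bop_mulE -exprSr (le_trans (rnorm_apply _ _))//.
  by rewrite ler_piMl// rnorm_ge0.
by apply: ler_sum => k _; rewrite -bop_mulE -exprSr.
Qed.

Lemma rota T (c : R) : 0 < c -> (forall z, spectrum T z -> cnorm z < c) ->
  exists2 A, selfadjoint ip A & rnorm (op_exp A * T * op_exp (- A)) <= c.
Proof.
move=> c0 hc; have [m m0 Tm] := gelfand_upper c0 hc.
pose S := (c^-1)%:C *: T.
have Sm : rnorm (S ^+ m) <= 1.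
  rewrite bop_exprZ rnormZ cnormX cnorm_real gtr0_norm ?invr_gt0//.
  by rewrite exprVn ler_pdivrMl ?exprn_gt0// mulr1.
have [A Asa hA] := similar_to_contraction m0 Sm; exists A => //.
have TE : T = c%:C *: S.
  by rewrite scalerA -rmorphM divff ?scale1r// gt_eqF.
have [inv _] := op_expN_inverse ip_norm Asa.
apply: rnorm_bop_le => [|y]; first exact: ltW.
rewrite TE bop_scaleAr bop_scaleAl bop_scaleE rnormZ cnorm_real gtr0_norm//.
rewrite ler_wpM2l ?(ltW c0)// !bop_mulE (le_trans (hA _))//.
by rewrite -bop_mulE inv.
Qed.

Lemma spectral_radius_le_aluthge (a : R) n T X Y : 0 <= a <= 1 -> op_inverse X Y ->
  spectral_radius T <= numerical_radius ip (iter n (aluthge ip a) (X * T * Y)).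
Proof.
move=> a01 XY; apply: spectral_radius_le => [|z Tz]; first exact: numerical_radius_ge0.
(* [spectrum_aluthge] transports nonzero spectral values only; the value 0 is bounded by any
   numerical radius. *)
have [->|z0] := eqVneq z 0; first by rewrite cnorm0; exact: numerical_radius_ge0.
apply: (spectrum_le_numerical_radius ip_norm).
by apply: spectrum_iter_aluthge => //; exact: spectrum_conj.
Qed.

Lemma aluthge_le_spectral_radius (a e : R) n T : 0 <= a <= 1 -> 0 < e ->
  exists2 A, selfadjoint ip A &
    numerical_radius ip (iter n (aluthge ip a) (op_exp A * T * op_exp (- A)))
      <= spectral_radius T + e.
Proof.
move=> a01 e0; have r0 := spectral_radius_ge0 T.
have c0 : 0 < spectral_radius T + e by lra.
have [|A Asa hA] := rota (T := T) c0.
  by move=> z /spectrum_le_radius; lra.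
exists A => //; apply: numerical_radius_le => //; first exact: ltW.
by rewrite (le_trans (rnorm_iter_aluthge _ _ _ _)).
Qed.

End rota.

Lemma inf_eq (R : realType) (D : set R) (r : R) : (forall x, D x -> r <= x) ->
  (forall e, 0 < e -> exists2 x, D x & x <= r + e) -> r = inf D.
Proof.
move=> lb ap; have [x0 Dx0 _] := ap _ ltr01.
apply/le_anti/andP; split; first by apply: lb_le_inf => //; exists x0.
apply/ler_addgt0Pr => e /ap[x Dx xe]; rewrite (le_trans _ xe)//.
by apply: ge_inf => //; exists r.
Qed.

Theorem theorem3p1 (R : realType) (H : completeNormedModType R[i])
    (ip : {dot H for (@Num.conj R[i])})
    (ip_norm : forall x : H, `|x| ^+ 2 = ip x x)
    (H_neq0 : exists x : H, x != 0)
    (lambda : R) (lambda01 : 0 <= lambda <= 1)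
    (T : bop H) (n : nat) :
  spectral_radius T =
    inf [set numerical_radius ip (iter n (aluthge ip lambda) (X * T * op_inv X))
        | X in [set X : bop H | op_invertible X]] /\
  spectral_radius T =
    inf [set numerical_radius ip
          (iter n (aluthge ip lambda) (op_exp A * T * op_exp (- A)))
        | A in [set A : bop H | selfadjoint ip A]].
Proof.
split; apply: inf_eq => [_ [X /= hX <-]|e e0].
- exact: spectral_radius_le_aluthge (op_invP hX).
- have [A Asa hA] := aluthge_le_spectral_radius ip_norm n T lambda01 e0.
  have inv := op_expN_inverse ip_norm Asa.
  eexists; last exact: hA; exists (op_exp A); first by exists (op_exp (- A)).
  by rewrite (op_invE inv).
- exact: spectral_radius_le_aluthge (op_expN_inverse ip_norm hX).
- have [A Asa hA] := aluthge_le_spectral_radius ip_norm n T lambda01 e0.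
  by eexists; last exact: hA; exists A.
Qed.
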